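(* For every $\varepsilon>0$ and every integer $g$ there is a $\{0,1\}$-weighted graph $G$ with an even number of vertices and girth at least $g$ for which, in game R, Bob has a strategy to obtain at least $(1-4\varepsilon)$ of the total weight of the vertices. Moreover: (1) there exists an infinite class $\mathcal{G}_{\varepsilon}$ of such graphs with maximum degree bounded by $O(\frac{1}{\varepsilon}\log(\frac{1}{\varepsilon}))$; in particular, $\mathcal{G}_{\varepsilon}$ has bounded expansion; (2) there is a class $\mathcal{G}$ with bounded local expansion of $\{0,1\}$-weighted graphs with an even number of vertices for which the infimum, over graphs in $\mathcal{G}$, of the fraction of the total weight that Alice can guarantee in game R is zero.
   Context: Game R: given a connected graph $G$ with nonnegative vertex weights, Alice and Bob alternately take one not-yet-taken vertex per turn, Alice first, subject to the rule that the subgraph of $G$ induced by the remaining (not yet taken) vertices is connected during the whole game; the game ends when all vertices are taken, and each player gains the total weight of the vertices taken. A class of graphs has bounded expansion if for every $r$ the average degrees of all $r$-shallow minors (minors obtained by contracting disjoint connected subgraphs of radius at most $r$ and deleting vertices/edges) of graphs in the class are bounded by a constant depending only on $r$. A class has bounded local expansion if for all $r,d$ the average degrees of $r$-shallow minors of subgraphs induced by balls of radius $d$ in graphs of the class are bounded by a constant depending only on $r$ and $d$ (in the sense of Nešetřil and Ossona de Mendez). *)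

(* Defs.v *)
(* MathComp / MathComp-Analysis. *)
From HB Require Import structures.
From mathcomp Require Import all_boot all_order all_algebra.
From mathcomp Require Import all_classical all_reals all_analysis.

Set Implicit Arguments.
Unset Strict Implicit.
Unset Printing Implicit Defensive.

Import Order.TTheory GRing.Theory Num.Theory.

Local Open Scope ring_scope.

Record sgraph := SGraph {
  vertex :> finType;
  adj : rel vertex;
  adj_sym : symmetric adj;
  adj_irr : irreflexive adj }.

Arguments adj {s}.

Section Induced.
Variables (G : sgraph) (A : {set G}).

Definition induced_adj : rel {x : G | x \in A} :=
  fun x y => adj (val x) (val y).

Lemma induced_adj_sym : symmetric induced_adj.
Proof. by move=> x y; rewrite /induced_adj adj_sym. Qed.

Lemma induced_adj_irr : irreflexive induced_adj.
Proof. by move=> x; rewrite /induced_adj adj_irr. Qed.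

Definition induced_graph : sgraph := SGraph induced_adj_sym induced_adj_irr.
End Induced.

(* The empty graph counts as connected, so that the last vertex may be taken. *)
Definition graph_connected (G : sgraph) : bool :=
  [forall x : G, forall y : G, connect adj x y].

Definition dist_le (G : sgraph) (d : nat) (x y : G) : bool :=
  [exists k : 'I_d.+1, [exists p : k.-tuple G,
     path adj x p && (last x p == y)]].

Definition gball (G : sgraph) (x : G) (d : nat) : {set G} :=
  [set y | dist_le d x y].

Definition radius_le (G : sgraph) (r : nat) : bool :=
  [exists c : G, forall x : G, dist_le r c x].

Definition degree (G : sgraph) (x : G) : nat := #|[set y | adj x y]|.

Definition max_degree (G : sgraph) : nat := (\max_(x : G) degree x)%N.

Definition avg_degree (R : realType) (G : sgraph) : R :=
  (\sum_(x : G) degree x)%N%:R / #|G|%:R.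

(* Forests have infinite girth.  [ucycle] also accepts sequences of length at
   most 2 (an edge walked back and forth), which are not cycles of a simple
   graph. *)
Definition girth_ge (G : sgraph) (g : nat) : Prop :=
  forall c : seq G, ucycle adj c -> (2 < size c)%N -> (g <= size c)%N.

Definition sgraph_iso (G H : sgraph) : Prop :=
  exists2 f : G -> H, bijective f & forall x y, adj (f x) (f y) = adj x y.

(* [B h] is the vertex set contracted to [h]; a set of vertices spans a subgraph
   of radius at most r iff the subgraph it induces has radius at most r, which
   entails that it is connected and nonempty.  Deleted vertices lie in no [B h],
   and deleted edges account for the one-sided condition on adjacency. *)
Definition shallow_minor (r : nat) (H G : sgraph) : Prop :=
  exists B : H -> {set G},
    [/\ forall h, radius_le (induced_graph (B h)) r,
        forall h k x, x \in B h -> x \in B k -> h = k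
      & forall h k, adj h k -> exists x y, [/\ x \in B h, y \in B k & adj x y]].

(* Classes of graphs are predicates: [set sgraph] is ruled out by universe
   constraints. *)
Definition bounded_expansion (R : realType) (C : sgraph -> Prop) : Prop :=
  forall r : nat, exists c : R, forall G H : sgraph,
    C G -> shallow_minor r H G -> avg_degree R H <= c.

Definition bounded_local_expansion (R : realType) (C : sgraph -> Prop) : Prop :=
  forall r d : nat, exists c : R, forall (G : sgraph) (x : G) (H : sgraph),
    C G -> shallow_minor r H (induced_graph (gball x d)) -> avg_degree R H <= c.

(* Infinite up to isomorphism. *)
Definition infinite_class (C : sgraph -> Prop) : Prop :=
  forall (n : nat) (s : 'I_n -> sgraph),
    exists2 G, C G & forall i, ~ sgraph_iso G (s i).

Record wgraph (R : realType) := WGraph {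
  ugraph :> sgraph;
  weight : ugraph -> R;
  weight_ge0 : forall x, 0 <= weight x }.

Definition underlying (R : realType) (C : wgraph R -> Prop) (H : sgraph) : Prop :=
  exists2 G : wgraph R, C G & H = G.

Section Game.
Variables (R : realType) (G : wgraph R).

Definition total_weight : R := \sum_(x : G) weight x.

Definition zero_one_weighted : Prop :=
  forall x : G, weight x = 0 \/ weight x = 1.

(* [h] lists the vertices taken so far, in order of play. *)
Definition legal (h : seq G) : Prop :=
  uniq h /\
  forall i, (i <= size h)%N ->
    graph_connected (induced_graph [set x : G | x \notin take i h]).

(* A player is a boolean: [false] (Alice) moves at the even times 0, 2, ...,
   [true] (Bob) at the odd ones. *)
Definition legal_strategy (b : bool) (s : seq G -> G) : Prop :=
  forall h, legal h -> (size h < #|G|)%N -> odd (size h) = b ->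
    legal (rcons h (s h)).

Definition follows (b : bool) (s : seq G -> G) (p : #|G|.-tuple G) : Prop :=
  forall i : 'I_#|G|, odd i = b -> tnth p i = s (take i p).

Definition gain (b : bool) (p : #|G|.-tuple G) : R :=
  \sum_(i < #|G| | odd i == b) weight (tnth p i).

Definition can_obtain (b : bool) (x : R) : Prop :=
  exists2 s, legal_strategy b s &
    forall p : #|G|.-tuple G, legal p -> follows b s p -> x <= gain b p.

Definition alice_can_obtain : R -> Prop := can_obtain false.
Definition bob_can_obtain : R -> Prop := can_obtain true.

Definition alice_fraction : R :=
  sup [set f : R | alice_can_obtain (f * total_weight)]%classic.

(* Without positive total weight, fractions of it would be meaningless. *)
Definition even_board : Prop :=
  [/\ graph_connected G, ~~ odd #|G|, zero_one_weighted & 0 < total_weight].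

Definition bob_gets_most (eps : R) : Prop :=
  even_board /\ bob_can_obtain ((1 - 4 * eps) * total_weight).
End Game.

(* Main.v *)
(** Take a connected graph H in which any two disjoint sets of m vertices are
    joined by an edge, and attach a pendant leaf of weight 0 to each vertex, all
    of which have weight 1.  A vertex of H cannot be taken before its leaf, so
    Bob answers the removal of a leaf by taking the uncovered vertex.  When this
    would disconnect the board, he retreats to the giant component K of the rest
    of H and takes a vertex away from K, which parity allows from then on
    whenever Alice plays away from K.  The vertices given up in this way are
    charged to vertices without neighbours in K, of which there are fewer than
    m, so Bob loses at most 5 m vertices.

    A random graph in which the sets of a fraction 1/q of the vertices are
    pairwise joined has average degree O(q log q); deleting its vertices of high
    degree and those on short cycles and passing to a giant component yields H.
    Balls of bounded radius in graphs of large girth are forests, whose minors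
    have average degree at most 2; this gives bounded local expansion. *)
Require Import Defs.
From HB Require Import structures.
From mathcomp Require Import all_boot all_order all_algebra.
From mathcomp Require Import all_classical all_reals all_analysis.
From mathcomp Require Import fintype finset zify ring lra.

Set Implicit Arguments.
Unset Strict Implicit.
Unset Printing Implicit Defensive.

Import Order.TTheory GRing.Theory Num.Theory.
Import numFieldNormedType.Exports.

Local Open Scope ring_scope.

(** * Connectivity *)

(** Connectedness through cuts, stated for vertex sets of one fixed graph, so that the shrinking
    board is handled without a new subtype for each position. The empty set qualifies. *)
Definition conn (G : sgraph) (S : {set G}) : Prop :=
  forall X : {set G}, X \subset S -> X != set0 -> X != S ->
    exists x y, [/\ x \in X, y \in S :\: X & adj x y].

(** A path that starts in [X] and ends outside has a step leaving [X]; conversely, the set of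
    vertices reachable from [x] has no edge to its complement. *)
Lemma conn_setT (G : sgraph) : graph_connected G <-> conn [set: G].
Proof.
split=> [/forallP cG X _ /set0Pn[x xX] XT|cG].
  have [y yX] : exists y, y \notin X.
    apply/existsP; apply: contraNT XT; rewrite negb_exists => /forallP XT.
    by apply/eqP/setP => y; move: (XT y); rewrite negbK inE => ->.
  have /connectP[p] := forallP (cG x) y.
  elim: p x xX => [|z p IH] x xX /=.
    by move=> _ yx; rewrite yx xX in yX.
  case/andP=> xz pz yp; have [zX|zX] := boolP (z \in X); first exact: IH pz yp.
  by exists x, z; split=> //; rewrite !inE zX.
apply/forallP => x; apply/forallP => y.
pose X := [set z | connect adj x z].
have xX : x \in X by rewrite inE.
have [XT|XT] := eqVneq X [set: G].
  by have : y \in X; [rewrite XT inE | rewrite inE].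
have [||u [v [uX]]] := cG X _ _ XT; rewrite ?subsetT //.
  by apply/set0Pn; exists x.
rewrite !inE andbT => vX uv; case/negP: vX.
by rewrite inE in uX; apply: connect_trans uX (connect1 uv).
Qed.

Lemma conn_induced (G : sgraph) (S : {set G}) :
  conn [set: induced_graph S] <-> conn S.
Proof.
split=> [cS X XS X0 XS'|cS X _ /set0Pn[x xX] XT].
  pose Y : {set induced_graph S} := [set z | val z \in X].
  have [|||x [y [xY yY xy]]] := cS Y.
  - exact: subsetT.
  - have [x xX] := set0Pn _ X0; apply/set0Pn.
    by exists (Sub x (subsetP XS x xX)); rewrite inE.
  - apply: contraNneq XS' => YT; rewrite eqEsubset XS.
    apply/subsetP => x xS.
    have : (Sub x xS : induced_graph S) \in Y by rewrite YT.
    by rewrite inE.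
  - exists (val x), (val y); split=> //; first by rewrite inE in xY.
    by move: yY; rewrite !inE andbT (valP y) andbT.
have [||| _ [v [/imsetP[u uX ->] vS uv]]] := cS (val @: X).
- by apply/subsetP => _ /imsetP[z _ ->]; exact: valP.
- by apply/set0Pn; exists (val x); apply: imset_f.
- apply: contraNneq XT => XS; apply/eqP/setP => z; rewrite inE.
  by rewrite -(mem_imset _ _ val_inj) XS (valP z).
move: vS; rewrite inE => /andP[vX vS].
exists u, (Sub v vS); split=> //.
by rewrite !inE andbT; apply: contraNN vX => vX; apply/imsetP; exists (Sub v vS).
Qed.

Lemma graph_connected_induced (G : sgraph) (S : {set G}) :
  graph_connected (induced_graph S) <-> conn S.
Proof.
by split=> [/conn_setT/conn_induced|/conn_induced/conn_setT].
Qed.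

Lemma conn1 (G : sgraph) (x : G) : conn [set x].
Proof. by move=> X; rewrite subset1 => /orP[] ->. Qed.

Lemma connU1 (G : sgraph) (S : {set G}) (x y : G) :
  conn S -> y \in S -> adj y x -> conn (x |: S).
Proof.
move=> cS yS yx; have [xS|xS] := boolP (x \in S); first by rewrite (setUidPr _) ?sub1set.
move=> X XS X0 XT; have [XSS|XSS] := eqVneq (X :&: S) S.
  exists y, x; split=> //.
    by have := yS; rewrite -XSS inE => /andP[].
  rewrite !inE eqxx andbT; apply: contraNN XT => xX.
  rewrite eqEsubset XS; apply/subsetP => z; rewrite !inE => /orP[/eqP->//|].
  by rewrite -{1}XSS inE => /andP[].
have [XS0|XS0] := eqVneq (X :&: S) set0.
  have xX : x \in X.
    have [z zX] := set0Pn _ X0; have := subsetP XS z zX.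
    rewrite !inE => /orP[/eqP<-//|zS].
    by have : z \in set0; [rewrite -XS0 inE zX | rewrite inE].
  exists x, y; split; rewrite ?[adj x y]adj_sym // !inE yS orbT andbT.
  by apply/negP => yX; have : y \in set0; [rewrite -XS0 inE yX | rewrite inE].
have [u [v [uX vS uv]]] := cS _ (subsetIr _ _) XS0 XSS.
exists u, v; split=> //; first by move: uX; rewrite inE => /andP[].
move: vS; rewrite !inE => /andP[vX vS].
by rewrite vS orbT andbT; apply: contraNN vX => ->.
Qed.

(** Take a largest connected [C] with [A] inside [C] and [C] properly inside [S]. Some edge leads
    from [C] to a vertex [x] of [S] outside it; by maximality [x |: C] is all of [S], so removing
    [x] leaves [C]. A player can thus always move while sparing a connected part of the board. *)
Lemma conn_removable (G : sgraph) (S A : {set G}) :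
  conn S -> conn A -> A \proper S -> A != set0 ->
  exists2 x, x \in S :\: A & conn (S :\ x).
Proof.
move=> cS cA AS A0.
pose P (n : nat) := `[< exists C : {set G}, [/\ A \subset C, C \proper S, conn C & #|C| = n] >].
have exP : exists n, P n by exists #|A|; apply/asboolP; exists A; split.
have ubP n : P n -> (n <= #|G|)%N.
  by move=> /asboolP[C [_ _ _ <-]]; exact: max_card.
case: (ex_maxnP exP ubP) => n /asboolP[C [AC CS cC Cn]] maxn.
have C0 : C != set0.
  by have [a aA] := set0Pn _ A0; apply/set0Pn; exists a; exact: (subsetP AC).
have [y [x [yC xS yx]]] := cS C (proper_sub CS) C0 (proper_neq CS).
move: xS; rewrite inE => /andP[xC xS].
have CxS : x |: C = S.
  apply/eqP; apply: contraT => CxS.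
  have : P #|x |: C|.
    apply/asboolP; exists (x |: C); split=> //.
    - by apply: subset_trans AC _; exact: subsetUr.
    - by rewrite properEneq CxS subUset sub1set xS (proper_sub CS).
    - exact: connU1 cC yC yx.
  by move/maxn; rewrite cardsU1 xC Cn add1n ltnn.
exists x.
  by rewrite inE xS andbT; apply: contraNN xC; apply: (subsetP AC).
suff -> : S :\ x = C by [].
by rewrite -CxS setU1K.
Qed.

(** * Graphs without bipartite holes, and their giant components *)

Definition joined (m : nat) (G : sgraph) : Prop :=
  forall A B : {set G}, [disjoint A & B] -> (m <= #|A|)%N -> (m <= #|B|)%N ->
    exists a b, [/\ a \in A, b \in B & adj a b].

Lemma giant_component (G : sgraph) (m : nat) (S : {set G}) :
  (0 < m)%N ->
  joined m G -> (3 * m <= #|S|)%N ->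
  exists C : {set G}, [/\ C \subset S, conn C,
    forall x y, x \in C -> y \in S :\: C -> ~~ adj x y & (#|S :\: C| < m)%N].
Proof.
move=> m0 Gm Sm.
pose closed (X : {set G}) := [forall x in X, forall y in S :\: X, ~~ adj x y].
(* [C] will be a smallest union of components of [S] that misses fewer than [m] vertices; [S] itself
   is a candidate. *)
pose P (X : {set G}) := [&& X \subset S, closed X & (#|S :\: X| < m)%N].
have PS : P S.
  rewrite /P subxx setDv cards0 m0 andbT /=.
  by apply/'forall_implyP => x _; apply/'forall_implyP => y; rewrite setDv inE.
case: (arg_minnP (fun X : {set G} => #|X|) PS) => C /and3P[CS cC Cm] minC.
have cCP x y : x \in C -> y \in S :\: C -> ~~ adj x y.
  by move=> xC yC; move/'forall_implyP: cC => /(_ _ xC)/'forall_implyP/(_ _ yC).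
(* A part of [C] without edges to the rest of [C] has none to the rest of [S] either. With [m] or
   more vertices it would, by joinedness, miss fewer than [m] vertices of [S], against the
   minimality of [C]. *)
have small (X : {set G}) : X \proper C ->
    (forall x y, x \in X -> y \in C :\: X -> ~~ adj x y) -> (#|X| < m)%N.
  move=> XC clX; rewrite ltnNge; apply/negP => mX.
  have cX x y : x \in X -> y \in S :\: X -> ~~ adj x y.
    move=> xX; rewrite inE => /andP[yX yS]; have [yC|yC] := boolP (y \in C).
      by apply: clX => //; rewrite inE yX.
    by apply: cCP; rewrite ?inE ?yC // (subsetP (proper_sub XC)).
  suff /minC : P X by rewrite leqNgt (proper_card XC).
  apply/and3P; split.
  - exact: subset_trans (proper_sub XC) CS.
  - by apply/'forall_implyP => x xX; apply/'forall_implyP => y; exact: cX.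
  - rewrite ltnNge; apply/negP => mSX.
    have [|a [b [aX bX]]] := Gm X (S :\: X) _ mX mSX; last by apply/negP; exact: cX.
    by rewrite disjoint_sym disjoints_subset; apply/subsetP => z; rewrite !inE => /andP[].
exists C; split=> //.
move=> X XC X0 XneC; apply: contrapT => noedge.
have noe x y : x \in X -> y \in C :\: X -> ~~ adj x y.
  by move=> xX yC; apply/negP => xy; apply: noedge; exists x, y.
have X1 : (#|X| < m)%N by apply: small => //; rewrite properEneq XneC.
have X2 : (#|C :\: X| < m)%N.
  apply: small => [|x y xC].
    have [x xX] := set0Pn _ X0; rewrite properE subsetDl /=.
    apply/subsetPn; exists x; first exact: (subsetP XC).
    by rewrite inE xX.
  move=> yC; rewrite adj_sym; apply: noe => //.
  by move: yC xC; rewrite !inE negb_and negbK => /andP[/orP[//|/negP yC] /yC].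
(* If [C] split into [X] and [C :\: X], then [S] would be covered by three sets of fewer than [m]
   vertices each. *)
have := cardsID C S; have := cardsID X C.
by rewrite (setIidPr CS) (setIidPr XC); lia.
Qed.

(** * Strategies *)

Definition remaining (R : realType) (G : wgraph R) (h : seq G) : {set G} :=
  [set x | x \notin h].

Lemma remaining_rcons (R : realType) (G : wgraph R) (h : seq G) (x : G) :
  remaining (rcons h x) = remaining h :\ x.
Proof. by apply/setP => y; rewrite !inE mem_rcons inE negb_or. Qed.

Lemma card_remaining (R : realType) (G : wgraph R) (h : seq G) :
  uniq h -> #|remaining h| = (#|G| - size h)%N.
Proof.
move=> uh; have -> : remaining h = ~: [set x in h] by apply/setP => x; rewrite !inE.
rewrite cardsCs setCK -(card_uniqP uh); congr (_ - _)%N.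
by apply: eq_card => x; rewrite inE.
Qed.

Lemma legal_nil (R : realType) (G : wgraph R) :
  graph_connected G -> legal (G := G) [::].
Proof.
move=> cG; split=> // i _; apply/graph_connected_induced => /=.
by move/conn_setT: cG; congr conn; apply/setP => x; rewrite !inE.
Qed.

Lemma legal_conn (R : realType) (G : wgraph R) (h : seq G) :
  legal h -> conn (remaining h).
Proof. by case=> _ /(_ _ (leqnn _))/graph_connected_induced; rewrite take_size. Qed.

Lemma legal_rcons (R : realType) (G : wgraph R) (h : seq G) (x : G) :
  legal (rcons h x) <-> [/\ legal h, x \in remaining h & conn (remaining h :\ x)].
Proof.
split=> [lx|[[uh lh] xh cx]].
  split; last by rewrite -remaining_rcons; exact: legal_conn.
    case: lx; rewrite rcons_uniq => /andP[xh uh] lx; split=> // i ih.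
    by have := lx i; rewrite size_rcons -cats1 takel_cat //; apply; exact: leqW.
  by case: lx; rewrite rcons_uniq inE => /andP[].
split; first by rewrite rcons_uniq uh andbT; rewrite inE in xh.
move=> i; rewrite size_rcons leq_eqVlt => /orP[/eqP->|].
  rewrite -(size_rcons h x) take_size; apply/graph_connected_induced.
  by rewrite -[[set _ | _]]/(remaining (rcons h x)) remaining_rcons.
by rewrite ltnS => ih; rewrite -cats1 takel_cat //; exact: lh.
Qed.

(** A connected set with at least two vertices has a non-cut vertex: apply [conn_removable] to a
    singleton. *)
Lemma can_move (R : realType) (G : wgraph R) (h : seq G) :
  legal h -> (size h < #|G|)%N -> exists x, legal (rcons h x).
Proof.
move=> lh hG; have : (0 < #|remaining h|)%N.
  by rewrite card_remaining ?subn_gt0 //; case: lh.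
rewrite card_gt0 => /set0Pn[x xR].
have [Rx|Rx] := eqVneq (remaining h) [set x].
  exists x; apply/legal_rcons; split=> //.
  rewrite Rx setDv => X; rewrite subset0 => /eqP->.
  by rewrite eqxx.
have [||y] := conn_removable (legal_conn lh) (conn1 (x := x)).
- by rewrite properEneq eq_sym Rx sub1set.
- by apply/set0Pn; exists x; rewrite inE.
by rewrite inE => /andP[_ yR] cy; exists y; apply/legal_rcons.
Qed.

(** The gain in an unfinished game; in a history without repetition, [index x h] is the time at
    which [x] is taken. *)
Definition gain_seq (R : realType) (G : wgraph R) (b : bool) (h : seq G) : R :=
  \sum_(x <- h | odd (index x h) == b) weight x.

Lemma gain_seq_rcons (R : realType) (G : wgraph R) (b : bool) (h : seq G) (x : G) :
  x \notin h ->
  gain_seq b (rcons h x) =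
    gain_seq b h + (if odd (size h) == b then weight x else 0).
Proof.
move=> xh; rewrite /gain_seq -cats1 big_cat /= big_mkcond [in RHS]big_mkcond /=.
congr (_ + _).
  by apply: eq_big_seq => y yh; rewrite index_cat yh.
by rewrite big_mkcond big_seq1 index_cat (negPf xh) /= eqxx addn0.
Qed.

Lemma gain_gain_seq (R : realType) (G : wgraph R) (b : bool) (p : #|G|.-tuple G) :
  uniq p -> gain b p = gain_seq b p.
Proof.
move=> up; rewrite /gain_seq big_tuple; apply: eq_bigl => i.
by rewrite (tnth_nth (tnth p i)) index_uniq ?size_tuple.
Qed.

(** Bob picks an answer that keeps [Inv] whenever one exists, and any legal move otherwise. The
    second choice makes the strategy legal also at positions that it would never reach itself. [Inv]
    is maintained at the even times only, that is, after complete rounds. *)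
Lemma bob_invariant (R : realType) (G : wgraph R) (r : R) (x0 : G)
    (Inv : seq G -> Prop) :
  graph_connected G -> ~~ odd #|G| -> Inv [::] ->
  (forall h x, ~~ odd (size h) -> ((size h).+1 < #|G|)%N -> Inv h ->
    legal (rcons h x) ->
    exists2 y, legal (rcons (rcons h x) y) & Inv (rcons (rcons h x) y)) ->
  (forall h, legal h -> size h = #|G| -> Inv h -> r <= gain_seq true h) ->
  bob_can_obtain G r.
Proof.
move=> cG oG Inv0 InvS InvE.
pose good h y := legal (G := G) (rcons h y) /\
  ((exists2 z, legal (rcons h z) & Inv (rcons h z)) -> Inv (rcons h y)).
have /boolp.choice[s sP] h : exists y, legal h -> (size h < #|G|)%N -> good h y.
  have [[z lz Iz]|noz] := pselect (exists2 z, legal (rcons h z) & Inv (rcons h z)).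
    by exists z.
  have [[y ly]|noy] := pselect (exists y, legal (G := G) (rcons h y)).
    by exists y.
  (* The default [x0] is returned where no legal continuation exists, hence for no legal unfinished
     history. *)
  by exists x0 => lh hG; case: noy; exact: can_move.
exists s => [h lh hG _|p lp ps]; first by have [] := sP _ lh hG.
have lt k : (k <= #|G|)%N -> legal (take k p).
  move=> kG; case: lp => up lp; split; first exact: take_uniq.
  move=> i ik; rewrite take_takel; last by move: ik; rewrite size_take size_tuple; case: ltnP; lia.
  by apply: lp; rewrite size_tuple; move: ik; rewrite size_take size_tuple; case: ltnP; lia.
have tS k (kG : (k < #|G|)%N) : take k.+1 p = rcons (take k p) (tnth p (Ordinal kG)).
  by rewrite (take_nth x0) ?size_tuple // (tnth_nth x0).
have Inv2 k : (k.*2 <= #|G|)%N -> Inv (take k.*2 p).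
  elim: k => [|k IH] kG; first by rewrite take0.
  have k1 : (k.*2 < #|G|)%N by rewrite doubleS in kG; lia.
  have k2 : (k.*2.+1 < #|G|)%N by rewrite doubleS in kG; lia.
  have stk : size (take k.*2 p) = k.*2 by rewrite size_takel // size_tuple; lia.
  have lk1 : legal (rcons (take k.*2 p) (tnth p (Ordinal k1))).
    by rewrite -tS; apply: lt.
  have [y ly Iy] := InvS (take k.*2 p) (tnth p (Ordinal k1)) ltac:(by rewrite stk odd_double)
    ltac:(by rewrite stk) (IH ltac:(lia)) lk1.
  rewrite doubleS tS.
  have -> : tnth p (Ordinal k2) = s (take k.*2.+1 p).
    by apply: ps; rewrite /= odd_double.
  have [] := sP _ (lt k.*2.+1 ltac:(lia)) ltac:(by rewrite size_takel ?size_tuple; lia).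
  by move=> _; apply; rewrite tS; exists y.
have up : uniq p by case: lp.
rewrite gain_gain_seq //; apply: InvE => //; first by rewrite size_tuple.
have := Inv2 #|G|./2; rewrite even_halfK //.
by move/(_ (leqnn _)); rewrite -[X in take X p](size_tuple p) take_size.
Qed.

(** A repetition-free play of full length enumerates the vertices, and each time is either even or
    odd. *)
Lemma gains_sum (R : realType) (G : wgraph R) (p : #|G|.-tuple G) :
  uniq p -> gain false p + gain true p = total_weight G.
Proof.
move=> up; rewrite /gain /total_weight.
have -> : \sum_(x : G) weight x = \sum_(x <- p) weight x.
  have pp : perm_eq p (index_enum G).
    apply: uniq_perm => //; first exact: index_enum_uniq.
    move=> x; rewrite mem_index_enum.
    have [||_ ->] := uniq_min_size (s2 := enum G) up; last by rewrite mem_enum.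
      by move=> y _; rewrite mem_enum.
    by rewrite -cardE size_tuple.
  by rewrite (perm_big _ pp).
rewrite big_tuple [RHS](bigID (fun i : 'I_#|G| => odd i == false)) /=; congr (_ + _).
by apply: eq_bigl => i; case: (odd i).
Qed.

(** Playing the two strategies against each other gives one complete legal play in which both
    guarantees hold, while the gains add up to the total weight. *)
Lemma alice_bob_bound (R : realType) (G : wgraph R) (x y : R) :
  graph_connected G -> alice_can_obtain G x -> bob_can_obtain G y ->
  x + y <= total_weight G.
Proof.
move=> cG [s ls sx] [t lt ty].
pose play := fix play n : seq G :=
  if n is n'.+1 then rcons (play n') ((if odd n' then t else s) (play n')) else [::].
have splay n : size (play n) = n by elim: n => //= n IH; rewrite size_rcons IH.
have lplay n : (n <= #|G|)%N -> legal (play n).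
  elim: n => [|n IH] nG /=; first exact: legal_nil.
  have nln := IH (ltnW nG).
  case: ifP => on; [apply: lt|apply: ls]; rewrite ?splay //.
have tplay n m : (n <= m)%N -> take n (play m) = play n.
  elim: m => [|m IH]; first by rewrite leqn0 => /eqP->.
  rewrite leq_eqVlt => /orP[/eqP->|nm]; first by rewrite -[X in take X _](splay m.+1) take_size.
  by rewrite /= -cats1 takel_cat ?splay // IH.
have sp : size (play #|G|) == #|G| by rewrite splay.
pose p := Tuple sp.
have lp : legal p by exact: lplay.
have tp (i : 'I_#|G|) : tnth p i = (if odd i then t else s) (take i p).
  have x0 := tnth p i.
  rewrite (tnth_nth x0) /= tplay; last exact: ltnW.
  have -> : nth x0 (play #|G|) i = nth x0 (take i.+1 (play #|G|)) i by rewrite nth_take.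
  by rewrite tplay //= nth_rcons splay ltnn eqxx.
have fA : follows false s p by move=> i oi; rewrite tp oi.
have fB : follows true t p by move=> i oi; rewrite tp oi.
rewrite -(gains_sum (p := p)); last by case: lp.
by rewrite lerD // ?sx ?ty.
Qed.

(** * Pendant leaves *)

Section Corona.
Variable H : sgraph.

(** The corona of [H]: [(v, true)] is the vertex [v] of [H] and [(v, false)] its pendant leaf. *)
Definition corona_adj : rel (H * bool) := fun x y =>
  if x.2 && y.2 then adj x.1 y.1 else (x.1 == y.1) && (x.2 != y.2).

Lemma corona_adj_sym : symmetric corona_adj.
Proof.
by move=> x y; rewrite /corona_adj andbC adj_sym (eq_sym x.1) (eq_sym x.2).
Qed.

Lemma corona_adj_irr : irreflexive corona_adj.
Proof. by move=> x; rewrite /corona_adj adj_irr !eqxx if_same. Qed.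

Definition corona : sgraph := SGraph corona_adj_sym corona_adj_irr.

Lemma corona_adjTT (x y : H) : adj ((x, true) : corona) (y, true) = adj x y.
Proof. by []. Qed.

Lemma corona_adjFT (x y : H) : adj ((x, false) : corona) (y, true) = (x == y).
Proof. by rewrite {1}/adj /= /corona_adj /= andbT. Qed.

Lemma corona_adjTF (x y : H) : adj ((x, true) : corona) (y, false) = (x == y).
Proof. by rewrite {1}/adj /= /corona_adj /= andbT. Qed.

Lemma corona_adjFF (x y : H) : adj ((x, false) : corona) (y, false) = false.
Proof. by rewrite {1}/adj /= /corona_adj /= andbF. Qed.

Definition over (K : {set H}) : {set corona} := [set x | x.1 \in K].

Lemma card_over (K : {set H}) : #|over K| = (2 * #|K|)%N.
Proof.
have -> : over K = setX K [set: bool].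
  by apply/setP => -[x b]; rewrite !inE andbT.
by rewrite cardsX cardsT card_bool mulnC.
Qed.

(** Either the cut separates some vertex from its leaf, and that edge crosses, or it consists of
    whole vertex-leaf pairs and an edge of [K] crosses. *)
Lemma conn_over (K : {set H}) : conn K -> conn (over K).
Proof.
move=> cK X XK X0 XneK.
have [/existsP[v /andP[vK vX]]|noe] := boolP [exists v, (v \in K) &&
    (((v, true) \in X) != ((v, false) \in X))].
  have [vT|vT] := boolP ((v, true) \in X).
    exists (v, true), (v, false); rewrite corona_adjTF !inE vK andbT; split=> //.
    by move: vX; rewrite vT; case: (_ \in X).
  exists (v, false), (v, true); rewrite corona_adjFT !inE vK vT; split=> //.
  by move: vX; rewrite (negPf vT); case: (_ \in X).
have sameX v b : v \in K -> ((v, b) \in X) = ((v, true) \in X).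
  move=> vK; case: b => //; apply/esym/eqP.
  by have /existsPn/(_ v) := noe; rewrite vK negbK.
pose Y := [set v | (v, true) \in X].
have [||| x [y [xY yY xy]]] := cK Y.
- by apply/subsetP => v; rewrite inE => /(subsetP XK); rewrite inE.
- have [[v b] vX] := set0Pn _ X0; apply/set0Pn; exists v.
  by have := subsetP XK _ vX; rewrite !inE /= => /(sameX _ b) <-.
- apply: contraNneq XneK => YK; rewrite eqEsubset XK; apply/subsetP => -[v b].
  by rewrite inE /= => vK; rewrite sameX //; move: vK; rewrite -{1}YK inE.
exists (x, true), (y, true); split=> //; first by rewrite inE in xY.
by move: yY; rewrite !inE.
Qed.

Lemma corona_leaf_adj (v : H) (x : corona) : adj ((v, false) : corona) x -> x = (v, true).
Proof. by case: x => u [] ; rewrite ?corona_adjFF // corona_adjFT => /eqP->. Qed.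

(** A leaf on a cycle would have the same vertex before and after it, so a cycle of length at least
    3 lies in [H]. *)
Lemma corona_girth (g : nat) : girth_ge H g -> girth_ge corona g.
Proof.
move=> Hg c /andP[cc uc] c2.
have core x : x \in c -> x.2.
  move=> xc; case: (rot_to xc) => i p cE.
  have : cycle adj (x :: p) by rewrite -cE rot_cycle.
  have : uniq (x :: p) by rewrite -cE rot_uniq.
  have : (2 < size (x :: p))%N by rewrite -cE size_rot.
  case: x {xc cE} => v [] //=.
  case: p => [|y p] //=; rewrite rcons_path => p2 /and3P[_ yp _].
  move=> /andP[/corona_leaf_adj yE /andP[_]].
  move=> ly; have /corona_leaf_adj lE : adj ((v, false) : corona) (last y p).
    by rewrite adj_sym.
  by move: yp; rewrite yE -lE; case: p p2 {lE ly} => //= z p _; rewrite mem_last.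
have cE : c = [seq (x, true) | x <- map fst c].
  rewrite -map_comp -[LHS]map_id; apply/eq_in_map => -[x b] /core /= -> //.
rewrite -(size_map fst); apply: Hg; last by rewrite size_map.
rewrite cE in cc uc; apply/andP; split; last by rewrite (map_uniq uc).
by move: cc; rewrite cycle_map.
Qed.

Lemma corona_degree (x : corona) : (degree x <= (max_degree H).+1)%N.
Proof.
case: x => v [].
  apply: (@leq_trans #|(v, false) |: [set (u, true) | u in [set u | adj v u]]|).
    apply/subset_leq_card/subsetP => -[u []]; rewrite inE.
      by rewrite corona_adjTT => vu; rewrite in_setU1; apply/orP; right; apply: imset_f; rewrite inE.
    by rewrite corona_adjTF !inE => /eqP->; rewrite eqxx.
  rewrite (leq_trans (leq_card_setU _ _)) // cards1 ltnS.
  apply: leq_trans (leq_imset_card _ _) _.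
  exact: (leq_bigmax (F := fun x : H => degree x)).
rewrite /degree (leq_trans (subset_leq_card (_ : _ \subset [set (v, true)]))) ?cards1 //.
by apply/subsetP => y; rewrite !inE => /corona_leaf_adj->.
Qed.

Definition isolated (K : {set H}) : {set H} :=
  [set x | (x \notin K) && [forall y in K, ~~ adj x y]].

Lemma isolatedP (K : {set H}) (x : H) :
  reflect (x \notin K /\ forall y, y \in K -> ~~ adj x y) (x \in isolated K).
Proof.
rewrite inE; apply: (iffP andP) => -[xK].
  by move=> /'forall_implyP xy; split=> // y /xy.
by move=> xy; split=> //; apply/'forall_implyP.
Qed.

Lemma isolatedS (K L : {set H}) : L \subset K -> isolated K \subset isolated L.
Proof.
move=> LK; apply/subsetP => x /isolatedP[xK xy]; apply/isolatedP; split.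
  by apply: contraNN xK; apply: (subsetP LK).
by move=> y yL; apply: xy; apply: (subsetP LK).
Qed.

Lemma isolated_small (m : nat) (K : {set H}) :
  joined m H -> (m <= #|K|)%N -> (#|isolated K| < m)%N.
Proof.
move=> Hm mK; rewrite ltnNge; apply/negP => mI.
have [|a [b [/isolatedP[_ aK] bK]]] := Hm _ _ _ mI mK; last by apply/negP/aK.
by rewrite disjoints_subset; apply/subsetP => x /isolatedP[xK _]; rewrite inE.
Qed.
End Corona.

(** * Bob's strategy on the corona *)

Section CoronaGame.
Variables (R : realType) (H : sgraph).

Lemma corona_weight_ge0 (x : corona H) : 0 <= x.2%:R :> R.
Proof. by rewrite ler0n. Qed.

Definition wcorona : wgraph R := WGraph corona_weight_ge0.

Lemma wcorona_weight (x : wcorona) : weight x = x.2%:R.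
Proof. by []. Qed.

Lemma card_wcorona : #|wcorona| = (2 * #|H|)%N.
Proof. by rewrite card_prod card_bool mulnC. Qed.

Lemma wcorona_total : total_weight wcorona = #|H|%:R.
Proof.
rewrite /total_weight -natr_sum -sum1_card; congr _%:R.
rewrite (eq_bigr (fun x : H * bool => nat_of_bool x.2)) //.
rewrite -(pair_bigA _ (fun (v : H) (b : bool) => nat_of_bool b)) /=.
by apply: eq_bigr => v _; rewrite big_bool.
Qed.

Lemma wcorona_even : conn [set: H] -> (0 < #|H|)%N -> even_board wcorona.
Proof.
move=> cH H0; split.
- apply/conn_setT; have := conn_over cH; congr conn.
  by apply/setP => x; rewrite !inE.
- by rewrite card_wcorona mul2n odd_double.
- by move=> x; rewrite wcorona_weight; case: x.2; [right|left].
- by rewrite wcorona_total ltr0n.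
Qed.

(* The vertices outside [K] not taken by Bob are at most twice as many as the
   isolated ones: each cut vertex that Bob gives up has a private witness among
   the vertices that it isolates from [K]. *)
Definition bob_inv (m : nat) (h : seq wcorona) : Prop :=
  (exists K : {set H}, [/\ conn K, (m <= #|K|)%N, over K \subset remaining h &
     #|H|%:R <= #|K|%:R + gain_seq true h + 2 * #|isolated K|%:R :> R]) \/
  #|H|%:R - 5 * m%:R <= gain_seq true h :> R.

Variable m : nat.
Hypotheses (m_gt0 : (0 < m)%N) (Hm : joined m H).

(** The waiting move: Bob takes some vertex away from [over C] while keeping the board connected.
    The invariant then holds for [C], since his gain does not decrease. *)
Lemma bob_shrink (h : seq wcorona) (a : wcorona) (C : {set H}) :
  ~~ odd (size h) -> legal (rcons h a) -> conn C -> (m <= #|C|)%N ->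
  over C \proper remaining (rcons h a) ->
  #|H|%:R <= #|C|%:R + gain_seq true h + 2 * #|isolated C|%:R :> R ->
  exists2 y, legal (rcons (rcons h a) y) & bob_inv m (rcons (rcons h a) y).
Proof.
move=> oh la cC mC CR CH.
have C0 : over C != set0 by rewrite -card_gt0 card_over; lia.
have [y yR cy] := conn_removable (legal_conn la) (conn_over cC) CR C0.
move: yR; rewrite inE => /andP[yC yR].
have ly : legal (rcons (rcons h a) y) by apply/legal_rcons.
exists y => //; left; exists C; split=> //.
  rewrite remaining_rcons; apply/subsetP => z zC; rewrite !inE.
  rewrite (contraTneq _ zC) => [|-> //].
  by have := subsetP (proper_sub CR) z zC; rewrite inE.
apply: le_trans CH _; rewrite lerD2r lerD2l.
have ah : a \notin h by case: la; rewrite rcons_uniq => /andP[].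
have yh : y \notin rcons h a by case: ly; rewrite rcons_uniq => /andP[].
rewrite !gain_seq_rcons // size_rcons /= (negPf oh) /= addr0 lerDl.
exact: ler0n.
Qed.

(** If [K] is small, the final bound holds already. If Alice plays away from [K], Bob does too. If
    she takes the leaf of a vertex [u] of [K], Bob takes [u] when [K :\ u] is its own giant
    component and the board stays connected; otherwise he retreats to that component, and some
    vertex newly isolated from it pays for [u]. *)
Lemma bob_round (h : seq wcorona) (a : wcorona) :
  ~~ odd (size h) -> ((size h).+1 < #|wcorona|)%N -> bob_inv m h ->
  legal (rcons h a) ->
  exists2 y, legal (rcons (rcons h a) y) & bob_inv m (rcons (rcons h a) y).
Proof.
move=> oh hG Ih la.
have [lh aR ca] := (legal_rcons h a).1 la.
have ah : a \notin h by case: la; rewrite rcons_uniq => /andP[].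
have gainS y : legal (rcons (rcons h a) y) ->
    gain_seq true (rcons (rcons h a) y) = gain_seq true h + y.2%:R.
  case; rewrite rcons_uniq => /andP[yh _] _.
  by rewrite !gain_seq_rcons // size_rcons /= (negPf oh) /= addr0.
suff [Hgain|//] : #|H|%:R - 5 * m%:R <= gain_seq true h :> R \/
    exists2 y, legal (rcons (rcons h a) y) & bob_inv m (rcons (rcons h a) y).
  have [|y ly] := can_move la; first by rewrite size_rcons.
  exists y => //; right; rewrite gainS //; apply: le_trans Hgain _.
  by rewrite lerDl ler0n.
case: Ih => [[K [cK mK KR HK]]|]; last by left.
have Ism := isolated_small Hm mK.
have [K3|K3] := leqP #|K| (3 * m).
  (* The constant 5: at most [3 * m] vertices in [K], plus twice fewer than [m] isolated ones. *)
  left; move: K3 Ism; rewrite -(ler_nat R) -(ltr_nat R) natrM => K3 Ism.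
  by move: HK; lra.
right; case: a aR ca ah la gainS => u b aR ca ah la gainS.
have [uK|uK] := boolP (u \in K); last first.
  apply: (bob_shrink oh la cK mK _ HK).
  have KR' : over K \subset remaining (rcons h (u, b)).
    rewrite remaining_rcons; apply/subsetP => -[v c] vK.
    rewrite in_setD1 (subsetP KR) // andbT.
    by apply: contraNneq uK => -[<- _]; rewrite inE in vK.
  (* Parity: after Alice's move the number of remaining vertices is odd, whereas [over K] has even
     size, so a vertex outside [over K] is left. *)
  rewrite properEcard KR' /=; have := subset_leq_card KR'.
  rewrite card_over (card_remaining (G := wcorona)); last by case: la.
  rewrite card_wcorona in hG *; rewrite size_rcons.
  by move: oh hG; clear; lia.
have Ru x : x \in K :\ u -> forall c, (x, c) \in remaining (rcons h (u, b)).
  move=> xK c; rewrite remaining_rcons !inE.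
  move: xK; rewrite !inE => /andP[xu xK]; have : (x, c) \in over K by rewrite inE.
  by move/(subsetP KR); rewrite inE => ->; rewrite andbT; apply: contra xu => /eqP[->].
have K1 : #|K| = #|K :\ u|.+1 by rewrite (cardsD1 u) uK.
have Ruc : (u, ~~ b) \in remaining (rcons h (u, b)).
  rewrite remaining_rcons in_setD1 (subsetP KR) ?inE //= andbT.
  by apply/eqP => -[]; case: b {aR ca ah la gainS Ru}.
case: b aR ca ah la gainS Ru Ruc => aR ca ah la gainS Ru Ruc.
  (* Alice cannot take [u] before its leaf: the leaf would be cut off from the rest of [K]. *)
  exfalso.
  have cR : conn (remaining (rcons h (u, true))) by exact: legal_conn.
  have [|||x [y [xE yR]]] := cR [set (u, false)].
  - by rewrite sub1set.
  - by apply/set0Pn; exists (u, false); rewrite inE.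
  - have /card_gt0P[v vK] : (0 < #|K :\ u|)%N by lia.
    apply: contraTneq (Ru v vK true) => <-; rewrite inE.
    by apply/eqP => -[].
  move: xE; rewrite inE => /eqP-> /corona_leaf_adj yE.
  by move: yR; rewrite yE remaining_rcons !inE eqxx /= andbF.
have [|C [CK cC Cclosed Csmall]] := giant_component m_gt0 Hm (_ : (3 * m <= #|K :\ u|)%N).
  by lia.
have CKm := cardsID C (K :\ u); rewrite (setIidPr CK) in CKm.
have mC : (m <= #|C|)%N by move: CKm Csmall K1 K3; clear; lia.
have CsK : C \subset K by apply: subset_trans CK _; exact: subD1set.
have IC := isolatedS CsK.
(* What is lost of [K] besides [u] has no neighbour in [C], and is newly isolated because it lay in
   [K]. *)
have TI : K :\ u :\: C \subset isolated C :\: isolated K.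
  apply/subsetP => x xT; rewrite inE; apply/andP; split.
    apply/negP => /isolatedP[/negP xK _]; apply: xK.
    by move: xT; rewrite !inE => /and3P[].
  apply/isolatedP; split; first by move: xT; rewrite inE => /andP[].
  by move=> y yC; rewrite adj_sym; exact: Cclosed.
have ICK := cardsID (isolated K) (isolated C); rewrite (setIidPr IC) in ICK.
have CR : over C \proper remaining (rcons h (u, false)).
  rewrite properE; apply/andP; split.
    by apply/subsetP => -[x c]; rewrite inE => xC; apply/Ru/(subsetP CK).
  apply/subsetPn; exists (u, true) => //; rewrite inE /=.
  by apply/negP => /(subsetP CK); rewrite !inE eqxx.
(* With [i] newly isolated vertices, passing to [C] costs at most [1 + i] vertices of [K], and the
   potential rises by [2 * i]; this suffices once [i] is positive. *)
have shrink : (0 < #|isolated C :\: isolated K|)%N ->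
    exists2 y, legal (rcons (rcons h (u, false)) y) &
      bob_inv m (rcons (rcons h (u, false)) y).
  move=> I0; apply: (bob_shrink oh la cC mC CR); apply: le_trans HK _.
  have : (#|K| + 2 * #|isolated K| <= #|C| + 2 * #|isolated C|)%N.
    have := subset_leq_card TI.
    by move: CKm ICK K1 I0; clear; lia.
  by rewrite -(ler_nat R) !natrD; lra.
have [T0|] := posnP #|K :\ u :\: C|; last first.
  by move=> T0; apply: shrink; apply: leq_trans T0 (subset_leq_card TI).
have {}T0 : C = K :\ u.
  by apply/eqP; rewrite eqEsubset CK -setD_eq0 -cards_eq0 T0.
(* If [u] may be taken, its weight 1 makes up for its loss from [K]. *)
have [cu|cu] := pselect (conn (remaining (rcons h (u, false)) :\ (u, true))).
  have lu : legal (rcons (rcons h (u, false)) (u, true)) by apply/legal_rcons.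
  exists (u, true) => //; left; exists C; split=> //.
    rewrite remaining_rcons; apply/subsetP => -[x c] xC; rewrite in_setD1.
    rewrite (subsetP (proper_sub CR)) // andbT; apply: contraTneq xC => -[-> _].
    by rewrite T0 !inE eqxx.
  rewrite gainS //=; apply: le_trans HK _.
  have : (#|K| + 2 * #|isolated K| <= #|C| + 1 + 2 * #|isolated C|)%N.
    by have := subset_leq_card IC; rewrite T0; move: K1; clear; lia.
  by rewrite -(ler_nat R) !natrD; lra.
(* Now [u] is a cut vertex of the board; a newly isolated vertex will be a neighbour of [u] in a
   part that [u] separates from [C]. *)
apply: shrink; rewrite card_gt0; apply/set0Pn.
apply: contrapT => noq; apply: cu => X XS X0 XneS; apply: contrapT => noXY.
set S := remaining (rcons h (u, false)) :\ (u, true) in XS XneS noXY.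
have SR : S \subset remaining (rcons h (u, false)) by exact: subD1set.
have CS : over C \subset S.
  apply/subsetP => -[x c] xC; rewrite in_setD1 (subsetP (proper_sub CR)) // andbT.
  by apply: contraTneq xC => -[-> _]; rewrite T0 !inE eqxx.
(* Since [over C] is connected, it lies on one side of the uncrossed cut; [Y] is the other side. *)
have [Y [YS Y0 YC noY]] : exists Y : {set corona H}, [/\ Y \subset S, Y != set0,
    over C \subset S :\: Y & forall x y, x \in Y -> y \in S :\: Y -> ~~ adj x y].
  have noX x y : x \in X -> y \in S :\: X -> ~~ adj x y.
    by move=> xX yS; apply/negP => xy; apply: noXY; exists x, y.
  have DDX : S :\: (S :\: X) = X by rewrite setDDr setDv set0U; apply/setIidPr.
  have [XC0|XC0] := eqVneq (X :&: over C) set0.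
    exists X; split=> //; apply/subsetP => z zC; rewrite inE (subsetP CS) // andbT.
    by apply/negP => zX; have : z \in set0; [rewrite -XC0 inE zX | rewrite inE].
  exists (S :\: X); split.
  - exact: subsetDl.
  - apply: contraNneq XneS => /eqP; rewrite setD_eq0 => SX.
    by rewrite eqEsubset XS.
  - rewrite DDX; have [XCC|XCC] := eqVneq (X :&: over C) (over C).
      by rewrite -XCC subsetIl.
    exfalso; have [x [y [xX yX]]] := conn_over cC (subsetIr X (over C)) XC0 XCC.
    apply/negP/noX; first by move: xX; rewrite inE => /andP[].
    move: yX; rewrite !inE negb_and => /andP[/orP[yX|/negP yC //] yC].
    by rewrite yX /=; have := subsetP CS y; rewrite !inE => /(_ yC).
  - by rewrite DDX => x y xS yX; rewrite adj_sym; exact: noX.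
(* With [u] still present the board is connected, so an edge leaves [Y], and it can only end in
   [(u, true)]. Its other end [q] is not the leaf of [u], which is gone; so [q] is a vertex of [H]
   adjacent to [u] but to no vertex of [C]. *)
have cR : conn (remaining (rcons h (u, false))) by exact: legal_conn.
have [|||x [y [xY yR xy]]] := cR Y.
- exact: subset_trans YS SR.
- exact: Y0.
- apply: contraTneq Ruc => <- /=; apply/negP => /(subsetP YS).
  by rewrite !inE eqxx.
have yE : y = (u, true).
  apply/eqP; apply: contraT => yu; have yS : y \in S :\: Y.
    by move: yR; rewrite inE => /andP[yY yR]; rewrite inE yY in_setD1 yu.
  by have := noY x y xY yS; rewrite xy.
case: x xY xy => q [] xY; rewrite yE; last first.
  rewrite corona_adjFT => /eqP qu; move: (subsetP SR _ (subsetP YS _ xY)).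
  by rewrite qu remaining_rcons !inE eqxx.
rewrite corona_adjTT => qu; apply: noq; exists q; rewrite inE; apply/andP; split.
  by apply/negP => /isolatedP[_ /(_ _ uK)]; rewrite qu.
apply/isolatedP; split.
  apply/negP => qC; have : (q, true) \in S :\: Y by apply: (subsetP YC); rewrite inE.
  by rewrite inE xY.
move=> z zC; rewrite -corona_adjTT; apply: noY => //.
by apply: (subsetP YC); rewrite inE.
Qed.

Lemma corona_bob : conn [set: H] -> (m <= #|H|)%N ->
  bob_can_obtain wcorona (#|H|%:R - 5 * m%:R).
Proof.
move=> cH mH.
have H0 : (0 < #|H|)%N by exact: leq_trans mH.
have [cG oG _ _] := wcorona_even cH H0.
have /card_gt0P[x0 _] : (0 < #|wcorona|)%N by rewrite card_wcorona; lia.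
apply: (bob_invariant x0 (Inv := bob_inv m)) => //.
- left; exists [set: H]; rewrite cardsT; split=> //.
    by apply/subsetP => x _; rewrite inE.
  by rewrite /gain_seq big_nil addr0 lerDl mulr_ge0.
- exact: bob_round.
(* At the end the board is empty and cannot contain [over K], so the second alternative of the
   invariant holds. *)
- move=> h [uh _] sh [[K [_ mK KR _]]|//].
  have : (#|over K| <= #|remaining h|)%N by exact: subset_leq_card.
  by rewrite card_over (card_remaining (G := wcorona)) // sh subnn; lia.
Qed.
End CoronaGame.

(** * Random graphs *)

Definition mean (R : realType) (T : finType) (F : T -> R) : R :=
  (\sum_t F t) / #|T|%:R.

Lemma mean_sum (R : realType) (T I : finType) (P : pred I) (F : I -> T -> R) :
  mean (fun t => \sum_(i | P i) F i t) = \sum_(i | P i) mean (F i).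
Proof. by rewrite /mean exchange_big /= mulr_suml. Qed.

Lemma le_mean (R : realType) (T : finType) (F F' : T -> R) :
  (forall t, F t <= F' t) -> mean F <= mean F'.
Proof. by move=> FF; rewrite ler_wpM2r ?invr_ge0 // ler_sum. Qed.

Lemma meanD (R : realType) (T : finType) (F F' : T -> R) :
  mean (fun t => F t + F' t) = mean F + mean F'.
Proof. by rewrite /mean big_split mulrDl. Qed.

Lemma meanZ (R : realType) (T : finType) (a : R) (F : T -> R) :
  mean (fun t => a * F t) = a * mean F.
Proof. by rewrite /mean -mulr_sumr mulrA. Qed.

Lemma mean_lt_ex (R : realType) (T : finType) (F : T -> R) (a : R) :
  (0 < #|T|)%N -> mean F < a -> exists t, F t < a.
Proof.
move=> T0; rewrite ltr_pdivrMr ?ltr0n // => FT.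
apply/existsP; apply: contraTT FT; rewrite negb_exists => /forallP FT.
rewrite -leNgt mulr_natr -sumr_const; apply: ler_sum => t _.
by rewrite leNgt FT.
Qed.

(** Independence of the values of a uniformly random function: the functions satisfying the
    constraints form a product of sets. *)
Lemma mean_ffun (R : realType) (K L : finType) (E : {set K}) (P : {set L}) :
  (0 < #|L|)%N ->
  mean (fun f : {ffun K -> L} => [forall e in E, f e \in P]%:R) =
    (#|P|%:R / #|L|%:R) ^+ #|E| :> R.
Proof.
move=> L0; rewrite /mean; have /card_gt0P[y0 _] := L0.
pose F (e : K) : pred L := fun l => (e \in E) ==> (l \in P).
have -> : \sum_(f : {ffun K -> L}) [forall e in E, f e \in P]%:R =
    #|pfamily y0 predT F|%:R :> R.
  rewrite -sum1_card natr_sum [in RHS]big_mkcond /=; apply: eq_bigr => f _.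
  have -> : [forall e in E, f e \in P] = (f \in pfamily y0 predT F).
    apply/'forall_implyP/pfamilyP => [fE|[_ fF] e]; last first.
      by have := fF e isT; rewrite -[f e \in F e]/(F e (f e)) /F => /implyP.
    split; first exact/subsetP.
    by move=> e _; rewrite -[f e \in F e]/(F e (f e)) /F; apply/implyP/fE.
  by case: (_ \in _).
rewrite card_pfamily foldrE big_image /= card_ffun -prod_nat_const.
rewrite !natr_prod -prodf_div (bigID (mem E)) /= [X in _ * X]big1 ?mulr1.
  rewrite -prodr_const; apply: eq_big => [e|e eE]; first by rewrite ?inE.
  by congr (_%:R / _); apply: eq_card => l; rewrite -[LHS]/(F e l) /F eE.
move=> e eE; rewrite (_ : #|F e| = #|L|) ?divff ?pnatr_eq0 -?lt0n //.
by apply: eq_card => l; rewrite -[LHS]/(F e l) /F (negPf eE).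
Qed.

Lemma indicator_le (R : realType) (b c : bool) : (b -> c) -> b%:R <= c%:R :> R.
Proof. by case: b => [-> //|_]; rewrite ler0n. Qed.

Section RandomGraph.
Variables (R : realType) (V : finType) (N : nat).
Local Notation coin := {ffun {set V} -> 'I_N.+1}.
Local Notation p := (N.+1%:R^-1 : R).

(* Unordered pairs are keys of a colouring with [N.+1] colours; those of colour
   [0] are the edges.  The values of the colouring at other sets are not used. *)
Definition radj (f : coin) : rel V := fun x y => (x != y) && (f [set x; y] == ord0).

Lemma radj_sym (f : coin) : symmetric (radj f).
Proof. by move=> x y; rewrite /radj eq_sym setUC. Qed.

Lemma radj_irr (f : coin) : irreflexive (radj f).
Proof. by move=> x; rewrite /radj eqxx. Qed.

Definition random_graph (f : coin) : sgraph := SGraph (@radj_sym f) (@radj_irr f).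

Lemma card_coin_gt0 : (0 < #|{: coin}|)%N.
Proof. by apply/card_gt0P; exists [ffun=> ord0]. Qed.

Lemma mean_zero (E : {set {set V}}) :
  mean (fun f : coin => [forall e in E, f e == ord0]%:R) = p ^+ #|E|.
Proof.
have -> : p = #|[set ord0 : 'I_N.+1]|%:R / #|'I_N.+1|%:R by rewrite cards1 card_ord mul1r.
rewrite -mean_ffun ?card_ord //; congr mean; apply/funext => f.
by congr _%:R; congr nat_of_bool; apply: eq_forallb => e; rewrite inE.
Qed.

Lemma mean_nonzero (E : {set {set V}}) :
  mean (fun f : coin => [forall e in E, f e != ord0]%:R) = (1 - p) ^+ #|E|.
Proof.
have -> : 1 - p = #|[set~ ord0 : 'I_N.+1]|%:R / #|'I_N.+1|%:R.
  rewrite cardsC1 card_ord /= -[N.+1%:R](natr1 N).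
  by field; rewrite natr1 pnatr_eq0.
rewrite -mean_ffun ?card_ord //; congr mean; apply/funext => f.
by congr _%:R; congr nat_of_bool; apply: eq_forallb => e; rewrite !inE.
Qed.

(** Sets of size exactly [m] suffice for the failure of joinedness, and keep the union bound
    short. *)
Definition unjoined (f : coin) (m : nat) : bool :=
  [exists AB : {set V} * {set V}, [&& [disjoint AB.1 & AB.2], #|AB.1| == m, #|AB.2| == m
    & [forall a in AB.1, forall b in AB.2, ~~ radj f a b]]].

Lemma unjoinedN (f : coin) (m : nat) : ~~ unjoined f m -> joined m (random_graph f).
Proof.
have sub (A : {set V}) : (m <= #|A|)%N -> exists2 B : {set V}, B \subset A & #|B| = m.
  elim: {A}#|A| {-2}A (erefl #|A|) => [|k IH] A Ak mA.
    by exists A => //; rewrite Ak; apply/eqP; move: mA; rewrite Ak leqn0 eq_sym.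
  move: mA; rewrite leq_eqVlt => /orP[/eqP mA|]; first by exists A.
  rewrite Ak ltnS; have /card_gt0P[x xA] : (0 < #|A|)%N by rewrite Ak.
  have Axk : #|A :\ x| = k by move: Ak; rewrite (cardsD1 x) xA => -[].
  move=> mk; have [|B BA Bm] := IH (A :\ x) Axk; first by rewrite Axk.
  by exists B => //; apply: subset_trans BA (subD1set _ _).
move=> /existsPn H A B AB /sub[A' AA' Am] /sub[B' BB' Bm].
have := H (A', B'); rewrite /= Am Bm !eqxx /=.
rewrite (disjointWl AA' (disjointWr BB' AB)) /=.
rewrite negb_forall => /existsP[a]; rewrite negb_imply => /andP[aA].
rewrite negb_forall => /existsP[b]; rewrite negb_imply negbK => /andP[bB ab].
by exists a, b; split; rewrite ?(subsetP AA') ?(subsetP BB').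
Qed.

(** Union bound over the pairs of disjoint [m]-sets: all [m ^ 2] pairs between the two sets must be
    non-edges. *)
Lemma mean_unjoined (m : nat) :
  mean (fun f : coin => (unjoined f m)%:R) <= 'C(#|V|, m)%:R ^+ 2 * (1 - p) ^+ (m ^ 2).
Proof.
pose D (AB : {set V} * {set V}) := [&& [disjoint AB.1 & AB.2], #|AB.1| == m & #|AB.2| == m].
pose E (AB : {set V} * {set V}) := [set [set a; b] | a in AB.1, b in AB.2].
have p1 : 0 <= 1 - p by rewrite subr_ge0 invf_le1 ?ltr0n // ler1n.
apply: (@le_trans _ _ (mean (fun f : coin => \sum_(AB | D AB)
    [forall e in E AB, f e != ord0]%:R))).
  apply: le_mean => f; case: (boolP (unjoined f m)) => [|_]; last first.
    by apply: sumr_ge0 => AB _; rewrite ler0n.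
  move=> /existsP[AB /and4P[AB0 A B noe]].
  have DAB : D AB by apply/and3P.
  rewrite (bigD1 AB) //= -[leLHS]addr0 lerD ?sumr_ge0 //.
  rewrite ler_nat; set b := [forall e in _, _]; suff -> : b by [].
  apply/'forall_implyP => _ /imset2P[x y xA yB ->].
  have := 'forall_implyP noe _ xA => /'forall_implyP/(_ _ yB).
  rewrite negb_and negbK => /orP[/eqP xy|//].
  by have := disjointFr AB0 xA; rewrite xy yB.
rewrite mean_sum.
apply: (@le_trans _ _ (\sum_(AB | D AB) (1 - p) ^+ (m ^ 2))).
  apply: ler_sum => -[A B] /and3P[/= AB0 /eqP Am /eqP Bm].
  (* As [A] and [B] are disjoint, distinct [(a, b)] give distinct unordered pairs, so there are
     [m ^ 2] independent keys. *)
  rewrite mean_nonzero /E curry_imset2X card_in_imset ?cardsX ?Am ?Bm ?mulnn //.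
  move=> [a b] [c d]; rewrite !inE /= => /andP[aA bB] /andP[cA dB] abcd.
  have : a \in [set c; d] by rewrite -abcd !inE eqxx.
  have : b \in [set c; d] by rewrite -abcd !inE eqxx orbT.
  rewrite !inE => /orP[/eqP bc|/eqP->] /orP[/eqP->//|/eqP ad].
  - by have := disjointFr AB0 cA; rewrite -bc bB.
  - by have := disjointFr AB0 cA; rewrite -bc bB.
  - by have := disjointFr AB0 aA; rewrite ad dB.
rewrite sumr_const -[leLHS]mulr_natl ler_wpM2r ?exprn_ge0 //.
rewrite -natrX ler_nat -mulnn -card_draws -cardsX.
apply/subset_leq_card/subsetP => -[A B] /and3P[_ A1 B1].
by rewrite !inE A1.
Qed.

Lemma mean_degree_sum :
  mean (fun f : coin => (\sum_(x : random_graph f) degree x)%N%:R) <= #|V|%:R ^+ 2 * p.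
Proof.
have -> : (fun f : coin => (\sum_(x : random_graph f) degree x)%N%:R) =
    (fun f => \sum_(x : V) \sum_(y : V) (radj f x y)%:R) :> (coin -> R).
  apply/funext => f; rewrite natr_sum; apply: eq_bigr => x _.
  rewrite /degree -sum1_card natr_sum big_mkcond /=.
  by apply: eq_bigr => y _; rewrite inE; case: ifP.
rewrite mean_sum; under eq_bigr do rewrite mean_sum.
apply: (@le_trans _ _ (\sum_(x : V) \sum_(y : V) p)); last first.
  by rewrite !sumr_const -mulrnA -[leLHS]mulr_natl natrM expr2.
apply: ler_sum => x _; apply: ler_sum => y _.
rewrite -[leRHS]expr1 -(cards1 [set x; y]) -mean_zero; apply: le_mean => f.
apply: indicator_le => /andP[_ xy].
by apply/'forall_implyP => e /set1P->.
Qed.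
End RandomGraph.

(** * Short cycles in the random graph *)

Section ShortCycles.
Variables (R : realType) (V : finType) (N : nat).
Local Notation coin := {ffun {set V} -> 'I_N.+1}.
Local Notation p := (N.+1%:R^-1 : R).

Definition steps (x : V) (s : seq V) : seq {set V} :=
  pairmap (fun a b => [set a; b]) x s.

Lemma steps_sub (x z : V) (s : seq V) (e : {set V}) :
  e \in steps x s -> z \in e -> z \in x :: s.
Proof.
elim: s x => //= y s IH x; rewrite inE => /orP[/eqP->|eys ze].
  by rewrite !inE => /orP[->//|->]; rewrite orbT.
by rewrite inE (IH y eys ze) orbT.
Qed.

Lemma steps_uniq (x : V) (s : seq V) : uniq (x :: s) -> uniq (steps x s).
Proof.
elim: s x => //= y s IH x /andP[xys uys]; rewrite IH // andbT.
apply/negP => /steps_sub xy; case/negP: xys.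
by apply: xy; rewrite !inE eqxx.
Qed.

(** The closing edge contains [x], hence can only equal the first edge, whose other end differs from
    the last vertex when [s] has at least two entries. *)
Lemma steps_cycle_uniq (x : V) (s : seq V) :
  uniq (x :: s) -> (1 < size s)%N -> uniq (steps x (rcons s x)).
Proof.
move=> uxs s1; rewrite /steps -cats1 pairmap_cat cat_uniq /= andbT orbF.
rewrite -[pairmap _ x s]/(steps x s) steps_uniq //=.
case: s uxs s1 => [|y [|z s]] //= /andP[xs /andP[ys uzs]] _.
have ly : last z s != y by apply: contraNneq ys => <-; exact: mem_last.
have lx : last z s != x by apply: contraNneq xs => <-; rewrite inE mem_last orbT.
rewrite inE negb_or; apply/andP; split.
  apply/eqP => /setP/(_ (last z s)).
  by rewrite !inE eqxx (negPf ly) (negPf lx).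
apply/negP => /(@steps_sub y x (z :: s)) xy; case/negP: xs.
by apply: xy; rewrite !inE eqxx orbT.
Qed.

Lemma radj_steps (f : coin) (x : V) (s : seq V) (e : {set V}) :
  path (radj f) x s -> e \in steps x s -> f e == ord0.
Proof.
elim: s x => //= y s IH x /andP[/andP[_ xy] ys].
by rewrite inE => /orP[/eqP->//|]; exact: IH.
Qed.

(** The edges of the cycle are distinct keys, all of which must have colour 0. *)
Lemma mean_ucycle (x : V) (s : seq V) : (1 < size s)%N ->
  mean (fun f : coin => (ucycleb (radj f) (x :: s))%:R) <= p ^+ (size s).+1.
Proof.
move=> s1; have [u|u] := boolP (uniq (x :: s)); last first.
  rewrite (_ : (fun f : coin => _) = fun=> 0).
    by rewrite /mean big1 // mul0r exprn_ge0 ?invr_ge0.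
  by apply/funext => f; rewrite /ucycleb (negPf u) andbF.
have <- : #|[set e in steps x (rcons s x)]| = (size s).+1.
  rewrite -(size_rcons s x) -(size_pairmap (fun a b => [set a; b]) x).
  rewrite -(card_uniqP (steps_cycle_uniq u s1)).
  by apply: eq_card => e; rewrite inE.
rewrite -mean_zero; apply: le_mean => f; apply: indicator_le => /andP[cf _].
by apply/'forall_implyP => e; rewrite inE; exact: radj_steps.
Qed.

(** The index [j] counts the vertices of the cycle other than [x], so the lengths range from 3 to
    [g] inclusive. *)
Definition short_cyclic (f : coin) (g : nat) : {set V} :=
  [set x | [exists j : 'I_g, (1 < j)%N &&
     [exists t : j.-tuple V, ucycleb (radj f) (x :: t)]]].

Lemma exists_le_sum (I : finType) (P : pred I) :
  [exists i, P i]%:R <= \sum_i (P i)%:R :> R.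
Proof.
case: existsP => [[i Pi]|_]; last by apply: sumr_ge0 => i _; rewrite ler0n.
rewrite (bigD1 i) //= Pi lerDl; apply: sumr_ge0 => j _; exact: ler0n.
Qed.

(** Union bound over the base point and the [j] further vertices of a cycle. *)
Lemma mean_short_cyclic (g : nat) :
  mean (fun f : coin => #|short_cyclic f g|%:R) <=
    \sum_(j < g) (#|V|%:R * p) ^+ j.+1.
Proof.
apply: (@le_trans _ _ (mean (fun f : coin => \sum_(x : V) \sum_(j < g | (1 < j)%N)
    \sum_(t : j.-tuple V) (ucycleb (radj f) (x :: t))%:R))).
  apply: le_mean => f; rewrite -sum1_card natr_sum big_mkcond /=.
  apply: ler_sum => x _; rewrite inE.
  apply: le_trans (_ : [exists j : 'I_g, (1 < j)%N &&
     [exists t : j.-tuple V, ucycleb (radj f) (x :: t)]]%:R <= _).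
    by case: ifP.
  apply: le_trans (exists_le_sum _) _; rewrite [leRHS]big_mkcond /=.
  by apply: ler_sum => j _; case: ifP => // _; exact: exists_le_sum.
rewrite mean_sum.
apply: (@le_trans _ _ (\sum_(x : V) \sum_(j < g) #|V|%:R ^+ j * p ^+ j.+1)).
  apply: ler_sum => x _; rewrite mean_sum big_mkcond /=; apply: ler_sum => j _.
  case: ifP => j1; last by rewrite mulr_ge0 ?exprn_ge0 ?invr_ge0.
  rewrite mean_sum; apply: (@le_trans _ _ (\sum_(t : j.-tuple V) p ^+ j.+1)).
    apply: ler_sum => t _; rewrite -[X in p ^+ X.+1](size_tuple t).
    by apply: mean_ucycle; rewrite size_tuple.
  by rewrite sumr_const card_tuple -[leLHS]mulr_natl natrX.
rewrite sumr_const -[leLHS]mulr_natl mulr_sumr ler_sum // => j _.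
by rewrite mulrA -exprS exprMn.
Qed.

Lemma short_cyclicP (f : coin) (g : nat) (c : seq V) :
  ucycle (radj f) c -> (2 < size c <= g)%N -> {subset c <= short_cyclic f g}.
Proof.
move=> /andP[cc uc] c2 x xc; case: (rot_to xc) => i s cE.
have sE : (size s).+1 = size c by rewrite -(size_rot i c) cE.
have sg : (size s < g)%N by rewrite sE; case/andP: c2.
rewrite inE; apply/existsP; exists (Ordinal sg); apply/andP; split => /=.
  by case/andP: c2; rewrite -sE.
apply/existsP; exists (in_tuple s) => /=.
by rewrite /ucycleb -cE rot_cycle rot_uniq cc.
Qed.
End ShortCycles.

(** * Estimates, and the alteration of the random graph *)

Lemma bin_le_expR (R : realType) (q m : nat) : (0 < q)%N ->
  'C(q * m, m)%:R <= expR (m%:R * (ln q%:R + 1)) :> R.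
Proof.
move=> q0; have q0' : 0 < q%:R :> R by rewrite ltr0n.
rewrite mulrDr mulr1 expRD expRM_natl lnK ?posrE //.
(* The term of index [m] in the binomial expansion of this power is ['C(q * m, m) / q ^ m]; the
   claim is the bound [(e q) ^ m]. *)
have : (q%:R^-1 + 1) ^+ (q * m) <= expR m%:R :> R.
  apply: (@le_trans _ _ (expR (q%:R^-1) ^+ (q * m))).
    by apply: lerXn2r; rewrite ?nnegrE ?expR_ge0 ?addr_ge0 ?invr_ge0 // addrC expR_ge1Dx.
  by rewrite -expRM_natl natrM mulrAC divff ?mul1r // lt0r_neq0.
have [mqm|] := leqP m (q * m); last by rewrite ltnNge leq_pmull.
rewrite exprD1n (bigD1 (Ordinal (mqm : m < (q * m).+1)%N)) //= => H.
rewrite -ler_pdivrMl ?exprn_gt0 // -exprVn; apply: le_trans H.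
rewrite mulr_natr lerDl; apply: sumr_ge0 => i _.
by rewrite mulrn_wge0 // exprn_ge0 ?invr_ge0.
Qed.

Lemma unjoined_bound (R : realType) (q l N m : nat) : (0 < q)%N -> (0 < l)%N ->
  2 * ln q%:R + 6 <= l%:R :> R -> m = (l * N.+1)%N ->
  'C(q * m, m)%:R ^+ 2 * (1 - N.+1%:R^-1) ^+ (m ^ 2) <= 4^-1 :> R.
Proof.
move=> q0 l0 ql mE; have N0 : 0 < N.+1%:R :> R by rewrite ltr0n.
have m1 : 1 <= m%:R :> R by rewrite ler1n mE muln_gt0 l0.
(* The exponent is at most [m * (2 * ln q + 2 - l)], hence at most [- 4 * m] by the choice of
   [l]. *)
apply: (@le_trans _ _ (expR (- 4))); last first.
  rewrite expRN lef_pV2 ?posrE ?expR_gt0 //.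
  by apply: le_trans (expR_ge1Dx 4); rewrite lerDr.
apply: (@le_trans _ _ (expR (m%:R * (ln q%:R + 1)) ^+ 2 * expR (- N.+1%:R^-1) ^+ (m ^ 2))).
  apply: ler_pM.
  - by rewrite exprn_ge0.
  - by rewrite exprn_ge0 // subr_ge0 invf_le1 // ler1n.
  - by rewrite lerXn2r ?nnegrE ?expR_ge0 // bin_le_expR.
  - rewrite lerXn2r ?nnegrE ?expR_ge0 ?expR_ge1Dx //.
    by rewrite subr_ge0 invf_le1 // ler1n.
rewrite -!expRM_natl -expRD ler_expR.
have -> : (m ^ 2)%:R * - N.+1%:R^-1 = - (m%:R * l%:R) :> R.
  rewrite -mulnn natrM mulrN -mulrA; congr (- (_ * _)).
  by rewrite mE natrM mulfK // gt_eqF.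
by nra.
Qed.

(** On [q * m] vertices with edge probability [1 / N.+1], the expected degree is at most
    [d = q * l]. Deleting the vertices of high degree or on short cycles leaves more than half of
    the vertices, and [H] is the giant component of what remains. *)
Lemma sparse_joined (R : realType) (q l g n0 : nat) :
  (6 <= q)%N -> (0 < l)%N -> 2 * ln q%:R + 6 <= l%:R :> R ->
  exists (H : sgraph) (m : nat), [/\ (0 < m)%N, conn [set: H], joined m H,
    (q * m <= 2 * (#|H| + m))%N &
    [/\ (n0 <= #|H|)%N, girth_ge H g & (max_degree H <= 16 * (q * l))%N]].
Proof.
move=> q6 l0 ql; pose d := (q * l)%N.
pose K := (\sum_(j < g) d ^ j.+1)%N.
(* [K] bounds the expected number of vertices on short cycles; [N] makes it at most a sixteenth of
   [q * m], and makes [H] have at least [n0] vertices. *)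
pose N := (n0 + 16 * K)%N; pose m := (l * N.+1)%N; pose V : finType := 'I_(q * m).
have d0 : (0 < d)%N by rewrite muln_gt0 l0; lia.
have m0 : (0 < m)%N by rewrite muln_gt0 l0.
have Nm : (N < m)%N by rewrite /m; nia.
have dE : (q * m)%:R * N.+1%:R^-1 = d%:R :> R.
  by rewrite /m mulnA natrM mulfK // pnatr_eq0.
have qm0 : 0 < (q * m)%:R :> R by rewrite ltr0n; lia.
have d0' : 0 < d%:R :> R by rewrite ltr0n.
pose coin := {ffun {set V} -> 'I_N.+1}.
(* Each of the three terms has mean at most 1/4, so some [f] keeps all of them below 1 at once. *)
pose F (f : coin) : R := (unjoined f m)%:R +
  ((4 * d%:R * (q * m)%:R)^-1 * (\sum_(x : random_graph f) degree x)%N%:R +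
   (4 / (q * m)%:R) * #|short_cyclic f g|%:R).
have [|f Ff] := mean_lt_ex (card_coin_gt0 V N) (F := F) (a := 1).
  rewrite /F meanD meanD !meanZ.
  have h1 : mean (fun f : coin => (unjoined f m)%:R) <= 4^-1 :> R.
    apply: le_trans (mean_unjoined _ _ _ _) _; rewrite card_ord.
    by apply: (@unjoined_bound R q l N m) => //; lia.
  have h2 : (4 * d%:R * (q * m)%:R)^-1 *
      mean (fun f : coin => (\sum_(x : random_graph f) degree x)%N%:R) <= 4^-1 :> R.
    rewrite ler_pdivrMl ?mulr_gt0 //; apply: le_trans (mean_degree_sum _ _ _) _.
    rewrite card_ord expr2 -mulrA dE le_eqVlt; apply/orP; left; apply/eqP.
    by field.
  have h3 : (4 / (q * m)%:R) * mean (fun f : coin => #|short_cyclic f g|%:R) <= 4^-1 :> R.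
    rewrite mulrAC ler_pdivrMr // -ler_pdivlMl //.
    apply: le_trans (mean_short_cyclic _ _ _ _) _; rewrite card_ord.
    under eq_bigr do rewrite dE -natrX; rewrite -natr_sum -/K.
    have : (16 * K <= q * m)%N by rewrite /N in Nm; nia.
    by rewrite -(ler_nat R) natrM; lra.
  by lra.
pose H0 := random_graph f.
have F1 : 0 <= (4 * d%:R * (q * m)%:R)^-1 * (\sum_(x : H0) degree x)%N%:R :> R.
  by rewrite mulr_ge0 // invr_ge0 !mulr_ge0 // ltW.
have F2 : 0 <= (4 / (q * m)%:R) * #|short_cyclic f g|%:R :> R.
  by rewrite mulr_ge0 // divr_ge0 // ltW.
have Hm : joined m H0.
  apply: unjoinedN; apply/negP => uf; have uf1 : (unjoined f m)%:R = 1 :> R by rewrite uf.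
  by move: Ff F1 F2; rewrite /F uf1 /H0; lra.
have F3 : 0 <= (unjoined f m)%:R :> R by [].
have degs : (\sum_(x : H0) degree x < 4 * d * (q * m))%N.
  rewrite -(ltr_nat R) (natrM R (4 * d)) (natrM R 4 d) -[ltRHS]mulr1 -ltr_pdivrMl ?mulr_gt0 //.
  by move: Ff F1 F2 F3; rewrite /F /H0; lra.
have cycs : (4 * #|short_cyclic f g| < q * m)%N.
  rewrite -(ltr_nat R) (natrM R 4) -[ltRHS]mul1r -ltr_pdivrMr //.
  by move: Ff F1 F2 F3; rewrite /F /H0 mulrAC; lra.
pose hi : {set H0} := [set x | 16 * d <= degree x]%N.
(* Markov's inequality: the degree sum is below [4 * d * (q * m)] and each vertex of [hi]
   contributes at least [16 * d]. *)
have his : (4 * #|hi| < q * m)%N.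
  have : (#|hi| * (16 * d) <= \sum_(x : H0) degree x)%N.
    rewrite -sum_nat_const [leqRHS](bigID (mem hi)) /=.
    by apply: leq_trans (leq_addr _ _); apply: leq_sum => x; rewrite inE.
  by move=> h; have := leq_ltn_trans h degs; move: d0; clear; nia.
pose S : {set H0} := short_cyclic f g.
have {}cycs : (4 * #|S| < q * m)%N := cycs.
pose U : {set H0} := ~: (hi :|: S).
have cU : (q * m < 2 * #|U|)%N.
  have := cardsC (hi :|: S); rewrite -/U card_ord.
  by have [+ _] := leq_card_setU hi S; move: his cycs; clear; lia.
have [|C [CU cC _ UC]] := giant_component m0 Hm (_ : 3 * m <= #|U|)%N.
  by move: cU q6; clear; nia.
have CU' := cardsID C U; rewrite (setIidPr CU) in CU'.
pose H := induced_graph C.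
have cardH : #|H| = #|C| by rewrite card_sig; apply: eq_card => x; rewrite inE.
exists H, m; split=> //.
- exact/conn_induced.
- move=> A B AB; rewrite -(card_imset A val_inj) -(card_imset B val_inj) => mA mB.
  have [|_ [_ [/imsetP[a aA ->] /imsetP[b bB ->] ab]]] := Hm _ _ _ mA mB.
    rewrite disjoints_subset; apply/subsetP => _ /imsetP[a aA ->]; rewrite inE.
    by apply/imsetP => -[b bB /val_inj ab]; have := disjointFr AB aA; rewrite ab bB.
  by exists a, b.
- by rewrite cardH; move: cU CU' UC; clear; lia.
split.
- by rewrite cardH; move: cU CU' UC q6 Nm; rewrite /N; clear; nia.
- move=> c /andP[cc uc] c2; rewrite leqNgt; apply/negP => cg.
  have uc' : ucycle (radj f) (map val c).
    by apply/andP; split; [rewrite cycle_map|rewrite (map_inj_uniq val_inj)].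
  have := short_cyclicP uc' (g := g); rewrite size_map c2 (ltnW cg) => /(_ isT) sub.
  case: c c2 sub {cc uc cg uc'} => // x c _ /(_ (val x)).
  rewrite mem_head => /(_ isT) xs.
  by have := subsetP CU _ (valP x); rewrite in_setC in_setU negb_or => /andP[_ /negP[]].
- apply/bigmax_leqP => x _; have := subsetP CU _ (valP x).
  rewrite in_setC in_setU negb_or inE -ltnNge => /andP[hx _]; apply: leq_trans (ltnW hx).
  rewrite /degree -(card_imset _ val_inj); apply/subset_leq_card/subsetP.
  by move=> z /imsetP[y + ->]; rewrite !inE.
Qed.

(** * Expansion *)

Lemma avg_degree_le (R : realType) (G : sgraph) (k : nat) :
  (\sum_(x : G) degree x <= k * #|G|)%N -> avg_degree R G <= k%:R.
Proof.
move=> Gk; have [G0|G0] := posnP #|G|.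
  by rewrite /avg_degree G0 invr0 mulr0.
by rewrite /avg_degree ler_pdivrMr ?ltr0n // -natrM ler_nat.
Qed.

Lemma dist_leP (G : sgraph) (d : nat) (x y : G) :
  reflect (exists p, [/\ path adj x p, last x p = y & (size p <= d)%N]) (dist_le d x y).
Proof.
apply: (iffP existsP) => [[k /existsP[p /andP[xp /eqP py]]]|[p [xp py pd]]].
  by exists p; split=> //; rewrite size_tuple -ltnS.
exists (inord (size p)); apply/existsP.
have sp : size p == (inord (size p) : 'I_d.+1) by rewrite inordK.
by exists (Tuple sp); rewrite /= xp py /=.
Qed.

Lemma card_bigcup (I T : finType) (P : pred I) (F : I -> {set T}) :
  (#|\bigcup_(i | P i) F i| <= \sum_(i | P i) #|F i|)%N.
Proof.
apply: (big_rec2 (fun (A : {set T}) n => #|A| <= n)%N); first by rewrite cards0.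
by move=> i n A _ An; rewrite (leq_trans (leq_card_setU _ _)) // leq_add2l.
Qed.

Lemma card_gball (G : sgraph) (D d : nat) (x : G) :
  (forall y : G, degree y <= D)%N -> (#|gball x d| <= D.+1 ^ d)%N.
Proof.
move=> GD; elim: d => [|d IH].
  rewrite expn0 -(cards1 x); apply/subset_leq_card/subsetP => y.
  by rewrite !inE => /dist_leP[[|z p] [_ /= <-]].
apply: (@leq_trans #|\bigcup_(z in gball x d) (z |: [set y | adj z y])|).
  apply/subset_leq_card/subsetP => y; rewrite inE => /dist_leP[p].
  case/lastP: p => [|p y'] [xp py pd].
    apply/bigcupP; exists x; last by rewrite !inE -py eqxx.
    by rewrite inE; apply/dist_leP; exists [::].
  move: xp py pd; rewrite rcons_path last_rcons size_rcons ltnS => /andP[xp py'] <- pd.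
  apply/bigcupP; exists (last x p); last by rewrite !inE py' orbT.
  by rewrite inE; apply/dist_leP; exists p.
apply: leq_trans (card_bigcup _ _) _.
rewrite expnSr; apply: leq_trans (_ : (\sum_(z in gball x d) D.+1 <= _)%N).
  apply: leq_sum => z _; rewrite cardsU1 -(add1n D); apply: leq_add; first exact: leq_b1.
  exact: GD.
by rewrite sum_nat_const leq_mul2r IH orbT.
Qed.

Lemma degree_induced (G : sgraph) (S : {set G}) (x : induced_graph S) :
  (degree x <= degree (val x))%N.
Proof.
rewrite /degree -(card_imset _ val_inj); apply/subset_leq_card/subsetP.
by move=> z /imsetP[y + ->]; rewrite !inE.
Qed.

Lemma degree_le_max (G : sgraph) (x : G) : (degree x <= max_degree G)%N.
Proof. exact: (leq_bigmax (F := fun x : G => degree x)). Qed.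

Lemma card_induced (G : sgraph) (S : {set G}) : #|induced_graph S| = #|S|.
Proof. by rewrite card_sig; apply: eq_card => x; rewrite inE. Qed.

Lemma radius_conn (G : sgraph) (r : nat) (S : {set G}) :
  radius_le (induced_graph S) r -> conn S.
Proof.
move=> /existsP[c /forallP cS]; apply/graph_connected_induced.
have cc z : connect adj c z.
  by have /dist_leP[p [cp pz _]] := cS z; apply/connectP; exists p.
apply/forallP => x; apply/forallP => y; apply: connect_trans (cc y).
by rewrite (sym_connect_sym (@adj_sym _)).
Qed.

Lemma radius_neq0 (G : sgraph) (r : nat) (S : {set G}) :
  radius_le (induced_graph S) r -> exists x, x \in S.
Proof. by move=> /existsP[c _]; exists (val c); exact: valP. Qed.

Lemma card_radius (G : sgraph) (r : nat) (S : {set G}) :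
  radius_le (induced_graph S) r -> (#|S| <= (max_degree G).+1 ^ r)%N.
Proof.
move=> /existsP[c /forallP cS]; rewrite -card_induced.
apply: leq_trans (card_gball (D := max_degree G) r c _); last first.
  by move=> y; apply: leq_trans (degree_induced y) (degree_le_max _).
by apply/subset_leq_card/subsetP => y _; rewrite inE.
Qed.

(** Each neighbour of [h] provides a vertex of its own branch set adjacent to [B h]. These vertices
    are distinct, and [B h] lies in a ball of radius [r] of its induced graph. *)
Lemma minor_degree (G H : sgraph) (r : nat) (h : H) :
  shallow_minor r H G -> (degree h <= (max_degree G).+1 ^ r * max_degree G)%N.
Proof.
move=> [B [Br Bdis Badj]]; have [x0 _] := radius_neq0 (Br h).
pose Y := \bigcup_(x in B h) [set y | adj x y].
have /boolp.choice[f fP] k : exists y, adj h k -> y \in B k /\ y \in Y.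
  have [hk|] := boolP (adj h k); last by exists x0.
  have [x [y [xh yk xy]]] := Badj h k hk; exists y => _; split=> //.
  by apply/bigcupP; exists x; rewrite ?inE.
apply: (@leq_trans #|Y|).
  rewrite /degree -(card_in_imset (f := f)) => [|k k']; last first.
    rewrite !inE => /fP[fk _] /fP[fk' _] ff.
    by apply: (Bdis _ _ (f k)); rewrite // ff.
  by apply/subset_leq_card/subsetP => _ /imsetP[k + ->]; rewrite inE => /fP[].
apply: leq_trans (card_bigcup _ _) _.
apply: leq_trans (_ : (\sum_(x in B h) max_degree G <= _)%N).
  by apply: leq_sum => x _; exact: degree_le_max.
by rewrite sum_nat_const leq_mul2r card_radius ?orbT.
Qed.

Lemma max_degree_expansion (R : realType) (C : sgraph -> Prop) (D : nat) :
  (forall G, C G -> (max_degree G <= D)%N) -> bounded_expansion R C.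
Proof.
move=> CD r; exists (D.+1 ^ r * D)%N%:R => G H CG GH.
apply: avg_degree_le; rewrite mulnC -sum_nat_const; apply: leq_sum => h _.
apply: leq_trans (minor_degree h GH) _.
apply: leq_mul; last exact: CD.
by case: r {GH} => // r; rewrite leq_exp2r // ltnS CD.
Qed.

Lemma card_minor (G H : sgraph) (r : nat) : shallow_minor r H G -> (#|H| <= #|G|)%N.
Proof.
move=> [B [Br Bdis _]].
have /boolp.choice[f fP] h : exists x, x \in B h by exact: radius_neq0 (Br h).
apply: (leq_card f) => h k hk; apply: (Bdis h k (f h)) => //.
by rewrite hk.
Qed.

Lemma avg_degree_minor (R : realType) (G H : sgraph) (r : nat) :
  shallow_minor r H G -> avg_degree R H <= #|G|%:R.
Proof.
move=> /card_minor GH; apply: le_trans (avg_degree_le (k := #|H|) _ _) _.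
  by rewrite -sum_nat_const; apply: leq_sum => h _; exact: max_card.
by rewrite ler_nat.
Qed.

(** * Minors of graphs whose edges all join a vertex to its parent *)

Section Parent.
Variables (G : sgraph) (par : G -> G).
Hypothesis par_adj : forall u v, adj u v -> u = par v \/ v = par u.

(** The vertices of [S] whose chain of parents reaches [y] inside [S] form a set that no edge leaves
    within [S]; so it is all of [S]. The chain of [z] stops at once, as [par z] is outside. *)
Lemma top_unique (S : {set G}) (y z : G) :
  conn S -> y \in S -> par y \notin S -> z \in S -> par z \notin S -> y = z.
Proof.
move=> cS yS pyS zS pzS.
pose X := [set x in S | `[< exists2 k, iter k par x = y &
  forall i, (i <= k)%N -> iter i par x \in S >]].
suff : z \in X.
  rewrite inE zS => /asboolP[[|k]] => [<- //|_ /(_ 1%N isT)].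
  by rewrite /= (negPf pzS).
have [->//|XS] := eqVneq X S.
have [||a [b [aX bX ab]]] := cS X _ _ XS.
- by apply/subsetP => x; rewrite inE => /andP[].
- apply/set0Pn; exists y; rewrite inE yS; apply/asboolP; exists 0%N => // i.
  by rewrite leqn0 => /eqP->.
move: bX; rewrite !inE => /andP[+ bS]; rewrite bS => /asboolP[].
move: aX; rewrite inE => /andP[aS /asboolP[k ky kS]].
have [ap|bp] := par_adj ab.
  exists k.+1; first by rewrite iterSr -ap.
  by move=> [|i] // ik; rewrite iterSr -ap; exact: kS.
case: k ky kS => [/= ay _|k ky kS]; first by rewrite -ay -bp bS in pyS.
exists k; first by rewrite bp -iterSr.
by move=> i ik; rewrite bp -iterSr; exact: kS.
Qed.

(** A branch set has at most one vertex with its parent outside, so [P] orients the edges of [H]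
    with out-degree at most 1. *)
Lemma parent_minor (H : sgraph) (r : nat) :
  shallow_minor r H G -> (\sum_(h : H) degree h <= 2 * #|H|)%N.
Proof.
move=> [B [Br Bdis Badj]].
pose P (h k : H) := (h != k) && [exists y in B h, par y \in B k].
have Padj h k : adj h k -> P h k || P k h.
  move=> hk; have hneqk : h != k by apply: contraTneq hk => ->; rewrite adj_irr.
  have [x [y [xh yk /par_adj[xy|yx]]]] := Badj h k hk; rewrite /P.
    rewrite (eq_sym k) hneqk; apply/orP; right; apply/existsP; exists y.
    by rewrite yk -xy.
  by rewrite hneqk; apply/orP; left; apply/existsP; exists x; rewrite xh -yx.
have P1 h : (\sum_k P h k <= 1)%N.
  have -> : (\sum_k P h k = #|[set k | P h k]|)%N.
    rewrite -sum1_card [RHS]big_mkcond; apply: eq_bigr => k _.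
    by rewrite inE; case: (P h k).
  apply/card_le1_eqP => k l.
  rewrite !inE => /andP[hk /existsP[y /andP[yh yk]]] /andP[hl /existsP[z /andP[zh zl]]].
  have notin m x : h != m -> par x \in B m -> par x \notin B h.
    by move=> hm xm; apply: contraNN hm => xh; rewrite (Bdis _ _ _ xh xm).
  have yz : y = z := top_unique (radius_conn (Br h)) yh (notin k y hk yk) zh (notin l z hl zl).
  by apply: (Bdis _ _ (par y)) => //; rewrite yz.
apply: (@leq_trans (\sum_(h : H) \sum_(k : H) (P h k + P k h))).
  apply: leq_sum => h _; rewrite /degree -sum1_card big_mkcond /=.
  apply: leq_sum => k _; rewrite inE; case: ifP => // /Padj.
  by case: (P h k); case: (P k h).
under eq_bigr do rewrite big_split.
rewrite big_split /= [X in (_ + X)%N]exchange_big /= addnn -mul2n leq_mul2l /=.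
by rewrite -sum1_card; apply: leq_sum => h _; exact: P1.
Qed.
End Parent.

(** * Unique short paths and balls in graphs of large girth *)

Lemma two_paths_cycle (G : sgraph) (x a b : G) (p q : seq G) :
  path (@adj G) x (a :: p) -> path (@adj G) x (b :: q) ->
  uniq (x :: a :: p) -> uniq (x :: b :: q) ->
  last a p = last b q -> a != b ->
  exists2 c, ucycle (@adj G) c & (2 < size c <= size (a :: p) + size (b :: q))%N.
Proof.
move=> xp xq up' uq' pq ab.
have [xNp up] : x \notin a :: p /\ uniq (a :: p) by exact/andP.
have [xNq uq] : x \notin b :: q /\ uniq (b :: q) by exact/andP.
have hasp : has (mem (b :: q)) (a :: p).
  by apply/hasP; exists (last a p); rewrite ?mem_last //= pq mem_last.
move: {-2}(a :: p) {-2}(b :: q) (erefl (a :: p)) (erefl (b :: q)) hasp xp xq xNp up xNq uq.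
(* [z] is the first vertex of one path that lies on the other; the cycle goes to [z] along the first
   path and returns along the second. *)
move=> p' q' pE qE hasp; case: (split_find hasp) pE => z p1 p2 /= zq p1q pE.
case/path.splitP: zq qE p1q => q1 q2 qE p1q.
rewrite !cat_path => /andP[xp1 _] /andP[xq1 _].
rewrite !mem_cat !negb_or !cat_uniq => /andP[xNp1 _] /and3P[up1 _ _].
move=> /andP[xNq1 _] /and3P[uq1 _ _].
exists (x :: rcons p1 z ++ rev q1).
  rewrite /ucycle /= rcons_cat cat_path xp1 last_rcons.
  have -> : rcons (rev q1) x = rev (belast x (rcons q1 z)).
    by rewrite belast_rcons rev_cons.
  have := rev_path (@adj G) x (rcons q1 z); rewrite last_rcons => ->.
  rewrite (eq_path (e' := @adj G)); last by move=> u v; rewrite adj_sym.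
  rewrite xq1 mem_cat mem_rev negb_or xNp1 cat_uniq up1 rev_uniq.
  move: xNq1 uq1; rewrite mem_rcons inE negb_or rcons_uniq => /andP[_ ->] /andP[zq1 ->].
  rewrite /= andbT; apply/hasPn => u; rewrite mem_rev mem_rcons inE negb_or => uq1.
  rewrite (contraTneq _ uq1) => [|-> //]; apply: contraNN p1q => up1'.
  by apply/hasP; exists u => //=; rewrite mem_cat mem_rcons inE uq1 orbT.
have := congr1 size pE; have := congr1 size qE.
rewrite /= !size_cat !size_rcons size_rev => sq sp; apply/andP; split; last by move: sq sp; clear; lia.
case: p1 {hasp xp1 xNp1 up1 p1q sp} pE => [|p0 p1] pE; last by rewrite /=; clear; lia.
case: q1 {xq1 xNq1 uq1 sq} qE => [|q0 q1] qE; last by rewrite /=; clear; lia.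
(* Length at most 2 would mean [z = a = b]. *)
by case: pE qE ab => -> _ [-> _]; rewrite eqxx.
Qed.

Lemma two_paths (G : sgraph) (x : G) (p q : seq G) :
  path (@adj G) x p -> path (@adj G) x q -> uniq (x :: p) -> uniq (x :: q) ->
  last x p = last x q -> p <> q ->
  exists2 c, ucycle (@adj G) c & (2 < size c <= size p + size q)%N.
Proof.
elim: p x q => [|a p IH] x [|b q] //.
- by move=> _ _ _ /andP[xq _] /= qx; rewrite qx mem_last in xq.
- by move=> _ _ /andP[xp _] _ /= px; rewrite -px mem_last in xp.
move=> xp xq up uq pq neq; have [ab|ab] := eqVneq a b; last exact: (two_paths_cycle xp xq up uq pq ab).
move: xp xq up uq pq neq; rewrite -ab => /andP[_ ap] /andP[_ aq] /andP[_ up] /andP[_ uq] pq neq.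
have [||c cc /andP[c2 cpq]] := IH a q ap aq up uq.
- exact: pq.
- by move=> pq'; apply: neq; rewrite pq'.
by exists c => //; rewrite c2 /=; apply: leq_trans cpq _; lia.
Qed.

(** Two paths from [x] with a common end and total length at most [2 * d + 1] coincide, or a cycle
    shorter than [g] would arise. The parent of [v] is the last vertex but one on its path [w v];
    the centre is its own parent. *)
Lemma ball_parent (G : sgraph) (x : G) (d g : nat) :
  girth_ge G g -> (d.*2.+1 < g)%N ->
  exists par : G -> G, forall u v, u \in gball x d -> v \in gball x d ->
    adj u v -> u = par v \/ v = par u.
Proof.
move=> Gg dg.
have path_uniq v p q : path (@adj G) x p -> path (@adj G) x q -> uniq (x :: p) -> uniq (x :: q) ->
    last x p = v -> last x q = v -> (size p + size q <= d.*2.+1)%N -> p = q.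
  move=> xp xq up uq pv qv pq; apply: contrapT => neq.
  have [|c cc /andP[c2 cpq]] := two_paths xp xq up uq _ neq; first by rewrite pv.
  by move: dg; rewrite ltnNge (leq_trans (Gg c cc c2) (leq_trans cpq pq)).
have /boolp.choice[w wP] v : exists p, v \in gball x d ->
    [/\ path (@adj G) x p, uniq (x :: p), last x p = v & (size p <= d)%N].
  have [|_] := boolP (v \in gball x d); last by exists [::].
  rewrite inE => /dist_leP[p [xp pv pd]].
  case/shortenP: xp pv pd => q xq uq qp qv pd; exists q => _; split=> //.
  by apply: leq_trans pd; apply: uniq_leq_size => //; case/andP: uq.
exists (fun v => last x (belast x (w v))) => u v ud vd uv.
have [xu uu lu su] := wP u ud; have [xv uv' lv sv] := wP v vd.
(* If [v] lies on the path to [u], then by uniqueness it is the last vertex before [u]; otherwise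
   extending the path to [u] by [v] gives the path to [v]. *)
have [vu|vu] := boolP (v \in x :: w u).
  right; have [p1 [p2 [wE pv]]] : exists p1 p2, w u = p1 ++ p2 /\ last x p1 = v.
    by case/splitPl: vu => p1 p2 pv; exists p1, p2.
  move: xu uu lu su; rewrite wE cat_path => /andP[xp1 _].
  rewrite -cat_cons cat_uniq last_cat size_cat => /and3P[up1 p2N _] pu s12.
  have up : u \notin x :: p1.
    case: p2 p2N pu {s12 wE} => [|y p2] p2N /= pu.
      by move: uv; rewrite -pu pv adj_irr.
    by apply: contraNN p2N => up; apply/hasP; exists u => //; rewrite -pu mem_last.
  have p1E : w v = p1 by apply: (path_uniq v) => //; move: sv s12; clear; lia.
  have [xw uw lw sw] := wP u ud.
  rewrite -wE; have -> : w u = rcons p1 u.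
    apply: (path_uniq u) => //; rewrite ?last_rcons ?size_rcons //; last by move: sw s12; clear; lia.
      by rewrite rcons_path xp1 pv adj_sym.
    by rewrite -rcons_cons rcons_uniq up up1.
  by rewrite belast_rcons.
left; have -> : w v = rcons (w u) v.
  apply: (path_uniq v) => //; rewrite ?last_rcons ?size_rcons //; last by move: sv su; clear; lia.
    by rewrite rcons_path xu lu.
  by rewrite -rcons_cons rcons_uniq vu uu.
by rewrite belast_rcons /= lu.
Qed.

Lemma ball_minor (G H : sgraph) (x : G) (d g r : nat) :
  girth_ge G g -> (d.*2.+1 < g)%N ->
  shallow_minor r H (induced_graph (gball x d)) ->
  (\sum_(h : H) degree h <= 2 * #|H|)%N.
Proof.
move=> Gg dg; have [par parP] := ball_parent x Gg dg.
(* On an edge of the ball the relevant parent is the other end, hence in the ball, and [insubd]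
   recovers it. *)
pose ipar (v : induced_graph (gball x d)) : induced_graph (gball x d) := insubd v (par (val v)).
have iparP u v : adj u v -> u = ipar v \/ v = ipar u.
  by move=> uv; rewrite /ipar; have [<-|<-] := parP _ _ (valP u) (valP v) uv; rewrite valKd; [left|right].
exact: (parent_minor iparP).

Qed.

(** For a fixed radius [d] only finitely many indices [i] fail [2 * d + 1 < i]; for those graphs the
    number of vertices is bound enough. *)
Lemma girth_local_expansion (R : realType) (Gs : nat -> sgraph) :
  (forall i, girth_ge (Gs i) i) ->
  bounded_local_expansion R (fun G => exists i, G = Gs i).
Proof.
move=> Gsi r d; exists (2 + \sum_(i < d.*2.+2) #|Gs i|)%N%:R.
move=> G x H [i Gi]; rewrite Gi in x *; move=> HG; have [di|di] := ltnP i d.*2.+2.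
  apply: le_trans (avg_degree_minor R HG) _; rewrite card_induced ler_nat.
  rewrite (bigD1 (Ordinal di)) //=; apply: leq_trans (max_card _) _.
  by rewrite addnCA leq_addr.
apply: le_trans (_ : 2%:R <= _); last by rewrite ler_nat leq_addr.
exact/avg_degree_le/(ball_minor (Gsi i) di HG).
Qed.

(** * The two classes *)

Lemma can_obtain_le (R : realType) (G : wgraph R) (b : bool) (x y : R) :
  x <= y -> can_obtain G b y -> can_obtain G b x.
Proof.
by move=> xy [s ls sy]; exists s => // p lp fp; exact: le_trans xy (sy p lp fp).
Qed.

Lemma can_obtain0 (R : realType) (G : wgraph R) (b : bool) (x0 : G) :
  can_obtain G b 0.
Proof.
have /boolp.choice[s sP] h : exists y, legal h -> (size h < #|G|)%N ->
    legal (G := G) (rcons h y).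
  have [[y ly]|noy] := pselect (exists y, legal (G := G) (rcons h y)); first by exists y.
  by exists x0 => lh hG; case: noy; exact: can_move.
exists s => [h lh hG _|p _ _]; first exact: sP.
by apply: sumr_ge0 => i _; exact: weight_ge0.
Qed.

(** By [alice_bob_bound], what Bob secures bounds every fraction open to Alice; the fraction 0 is
    always open to her, so the supremum is taken over a nonempty bounded set. *)
Lemma alice_fraction_bounds (R : realType) (G : wgraph R) (eps : R) :
  bob_gets_most G eps -> 0 <= alice_fraction G <= 4 * eps.
Proof.
move=> [[cG _ _ G0] bob]; have [x0 _] : exists x0 : G, True.
  have /card_gt0P[x _] : (0 < #|G|)%N; last by exists x.
  rewrite lt0n; apply: contraTneq G0 => /eqP G0.
  by rewrite /total_weight big_pred0 ?ltxx // => x; apply: (card0_eq (eqP G0)).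
have ub f : alice_can_obtain G (f * total_weight G) -> f <= 4 * eps.
  move=> alice; have := alice_bob_bound cG alice bob.
  by rewrite mulrBl mul1r => ?; rewrite -(ler_pM2r G0); lra.
have zero : alice_can_obtain G (0 * total_weight G).
  by rewrite mul0r; exact: can_obtain0.
apply/andP; split.
  apply: ub_le_sup => //.
  by exists (4 * eps) => f; exact: ub.
apply: ge_sup; first by exists 0.
by move=> f; exact: ub.
Qed.

(** The value [q] exceeds [5 / eps + 5], so that Bob's loss [5 * m] is at most [4 * eps * #|H|] when
    [q * m <= 2 * (#|H| + m)]. *)
Definition separation (R : realType) (eps : R) : nat := (Num.truncn (5 / eps) + 6)%N.

Definition density (R : realType) (eps : R) : nat :=
  (Num.truncn (2 * ln (separation eps)%:R + 6 : R)).+1.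

Definition degree_bound (R : realType) (eps : R) : nat :=
  (16 * (separation eps * density eps)).+1.

Lemma bob_graph (R : realType) (eps : R) (g n0 : nat) : 0 < eps ->
  exists G : wgraph R, [/\ bob_gets_most G eps, girth_ge G g,
    (max_degree G <= degree_bound eps)%N & (n0 <= #|G|)%N].
Proof.
move=> e0; pose q := separation eps.
have q6 : (6 <= q)%N by rewrite /q /separation leq_addl.
(* Asking for [n0.+1] vertices also makes [H] nonempty. *)
have [||H [m [m0 cH Hm qm [nH gH dH]]]] :=
  @sparse_joined R q (density eps) g n0.+1 q6.
- by [].
- exact/ltW/truncnS_gt.
have H0 : (0 < #|H|)%N by exact: leq_trans nH.
exists (wcorona R H); split.
- split; first exact: wcorona_even.
  apply: can_obtain_le (corona_bob R m0 Hm cH _); last by move: qm q6; clear; nia.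
  rewrite wcorona_total.
  have q5 : 5 / eps + 5 <= q%:R.
    by rewrite /q /separation natrD; have := truncnS_gt (5 / eps); rewrite -natr1; lra.
  have {}q5 : 5 + 5 * eps <= q%:R * eps.
    by move: q5; rewrite -(ler_pM2r e0) mulrDl divfK // gt_eqF.
  move: qm; rewrite -(ler_nat R) !natrM natrD => qm.
  have m0' : 0 < m%:R :> R by rewrite ltr0n.
  by nra.
- exact: corona_girth.
- apply/bigmax_leqP => x _; apply: leq_trans (corona_degree x) _.
  by rewrite /degree_bound ltnS.
- by rewrite card_wcorona; lia.
Qed.

Local Open Scope classical_set_scope.

Lemma degree_bound_bigO (R : realType) :
  (fun eps : R => (degree_bound eps)%:R : R) =O_ (0^'+) (fun eps : R => eps^-1 * ln (eps^-1)).
Proof.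
apply/eqO_exP.
(* Near 0, with [t = 1 / e], [separation e] is at most [11 * t] and [density e] at most [7 * ln t];
   1233 is [16 * 11 * 7 + 1]. *)
exists 1233; first by rewrite ltr0n.
near=> e.
have e0 : 0 < e by near: e; exact: nbhs_right_gt.
have e8 : e < expR (- 8) by near: e; apply: nbhs_right_lt; exact: expR_gt0.
set t := e^-1; have t0 : 0 < t by rewrite invr_gt0.
have L8 : 8 <= ln t.
  rewrite -(expRK 8) ler_ln ?posrE ?expR_gt0 // -[leLHS]invrK -expRN lef_pV2 ?posrE ?expR_gt0 //.
  exact: ltW.
have t1 : 1 <= t.
  by have := ln_sublinear t0; lra.
rewrite ger0_norm // ger0_norm; last by rewrite mulr_ge0 ?ltW //; lra.
have qt : (separation e)%:R <= 11 * t.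
  rewrite /separation natrD.
  have /truncn_itv/andP[+ _] : 0 <= 5 / e by rewrite divr_ge0 // ltW.
  by rewrite -/t; lra.
have q0 : 0 < (separation e)%:R :> R by rewrite ltr0n /separation addnS.
have lnq : ln (separation e)%:R <= 3 * ln t.
  have : ln (separation e)%:R <= ln (11 * t) by rewrite ler_ln ?posrE // mulr_gt0.
  rewrite lnM ?posrE //; have : ln (11 : R) < 11 by exact: ln_sublinear.
  by lra.
have lnq0 : 0 <= ln (separation e)%:R :> R.
  by apply: ln_ge0; rewrite ler1n /separation addnS.
have lt : (density e)%:R <= 7 * ln t.
  rewrite /density -natr1.
  have /truncn_itv/andP[+ _] : 0 <= 2 * ln (separation e)%:R + 6 :> R by lra.
  by lra.
rewrite /degree_bound -natr1 !natrM.
have : (separation e)%:R * (density e)%:R <= (11 * t) * (7 * ln t) :> R.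
  by apply: ler_pM.
have : 1 <= t * ln t by nra.
by lra.
Unshelve. all: by end_near.
Qed.

Theorem theorem2 (R : realType) :
  (forall (eps : R) (g : nat), 0 < eps ->
     exists2 G : wgraph R, bob_gets_most G eps & girth_ge G g) /\
  (exists2 D : R -> R,
     D =O_ (0^'+) (fun eps : R => eps^-1 * ln (eps^-1)) &
     forall eps : R, 0 < eps ->
       exists C : wgraph R -> Prop,
         [/\ forall G, C G -> bob_gets_most G eps,
             forall g : nat,
               infinite_class (underlying (fun G => C G /\ girth_ge G g)),
             forall G, C G -> (max_degree G)%:R <= D eps
           & bounded_expansion R (underlying C)]) /\
  (exists C : wgraph R -> Prop,
     [/\ exists G, C G,
         forall G, C G -> even_board G,
         bounded_local_expansion R (underlying C)
       & inf [set f : R | exists2 G, C G & f = alice_fraction G] = 0]).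
Proof.
split=> [eps g e0|]; first by have [G [? ? _ _]] := bob_graph g 0 e0; exists G.
split.
  exists (fun eps => (degree_bound eps)%:R); first exact: degree_bound_bigO.
  move=> eps e0.
  exists (fun G => bob_gets_most G eps /\ (max_degree G <= degree_bound eps)%N); split.
  - by move=> G [].
  (* A graph with more vertices than all listed graphs together is isomorphic to none of them. *)
  - move=> g n s; have [G [? ? ? Gn]] := bob_graph g (\sum_i #|s i|).+1 e0.
    exists (ugraph G); first by exists G.
    move=> i [f /bij_eq_card Gs _]; move: Gn; rewrite Gs (bigD1 i) //=.
    by rewrite ltnNge leq_addr.
  - by move=> G [_]; rewrite ler_nat.
  - apply: (@max_degree_expansion R _ (degree_bound eps)).
    by move=> _ [G [_ ?] ->].
(* One graph per index: the girth tends to infinity, which gives local expansion, while Alice's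
   share is at most [4 / i.+1]. *)
have /boolp.choice[Gs GsP] i : exists G : wgraph R, bob_gets_most G (i.+1%:R^-1) /\ girth_ge G i.
  have [|G [? ? _ _]] := @bob_graph R (i.+1%:R^-1) i 0; last by exists G.
  by rewrite invr_gt0 ltr0n.
exists (fun G => exists i, G = Gs i); split.
- by exists (Gs 0%N), 0%N.
- by move=> _ [i ->]; have [[]] := GsP i.
- move=> r d; have [i|c cP] := @girth_local_expansion R Gs _ r d; first by have [] := GsP i.
  exists c => G x H [_ [i ->] GE]; apply: cP; by exists i.
have bounds i := alice_fraction_bounds (GsP i).1.
apply/eqP; rewrite eq_le; apply/andP; split; last first.
  apply: lb_le_inf; first by exists (alice_fraction (Gs 0%N)), (Gs 0%N) => //; exists 0%N.
  by move=> _ [_ [i ->] ->]; have /andP[] := bounds i.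
apply/ler_addgt0Pl => e e0; rewrite addr0.
pose i := Num.truncn (4 / e).
apply: (@le_trans _ _ (alice_fraction (Gs i))).
  apply: ge_inf; last by exists (Gs i) => //; exists i.
  by exists 0 => _ [_ [j ->] ->]; have /andP[] := bounds j.
have /andP[_ h] := bounds i; apply: le_trans h _.
rewrite ler_pdivrMr ?ltr0n // -ler_pdivrMl // mulrC; exact/ltW/truncnS_gt.
Qed.
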